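(* Let $\alpha_k$ be the coefficients in the asymptotic expansion $\pi G_n\sim \ln(16N)+\gamma+\sum_{k=1}^\infty \frac{\alpha_k}{N^k}$ ($n\to\infty$, $N=n+1$) of the Landau constants $G_n$. Then, as $k\to\infty$, $$\alpha_{2k}=(-1)^{k+1}\frac{2(2k-2)!}{(2\pi)^{2k}}\left(1+O\left(\frac1k\right)\right)$$ and $$\alpha_{2k+1}=(-1)^{k+1}\frac{8(2k)!\,\ln(2k+1)}{(2\pi)^{2k+2}}\left(1+O\left(\frac1{\ln k}\right)\right).$$
   Context: The Landau constants are $G_0=1$ and $G_n=1+\left(\frac12\right)^2+\left(\frac{1\cdot 3}{2\cdot 4}\right)^2+\cdots+\left(\frac{1\cdot3\cdots(2n-1)}{2\cdot4\cdots(2n)}\right)^2$ for $n=1,2,\dots$. Write $N=n+1$, and let $\gamma=0.577215\ldots$ be Euler's constant. It is known that there are (unique) real constants $\alpha_1,\alpha_2,\dots$ such that, as $n\to\infty$, $\pi G_n\sim \ln(16N)+\gamma+\sum_{k=1}^\infty\frac{\alpha_k}{N^k}$; that is, for every integer $m\ge 0$, $\pi G_n=\ln(16N)+\gamma+\sum_{k=1}^m\frac{\alpha_k}{N^k}+O(N^{-m-1})$ as $n\to\infty$. *)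

(* Defs.v *)
(* Stdlib reals with Coquelicot. *)
From Stdlib Require Export Reals Factorial.
From Coquelicot Require Export Coquelicot.
Open Scope R_scope.

(* (1*3*...*(2j-1)) / (2*4*...*(2j)), the empty product for j = 0. *)
Fixpoint odd_even_ratio (j : nat) : R :=
  match j with
  | O => 1
  | S i => odd_even_ratio i * (INR (2 * i + 1) / INR (2 * i + 2))
  end.

Definition landau (n : nat) : R := sum_n (fun j => odd_even_ratio j ^ 2) n.

Definition euler_gamma : R :=
  real (Lim_seq (fun n => sum_n_m (fun k => / INR k) 1 n - ln (INR n))).

Definition is_bigO (f g : nat -> R) : Prop :=
  exists C : R, eventually (fun n => Rabs (f n) <= C * Rabs (g n)).

(* The expansion is in powers of N = n + 1, not of n; [alpha 0] is never used,
   and for m = 0 the sum from 1 to m is empty. *)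
Definition is_landau_expansion (alpha : nat -> R) : Prop :=
  forall m : nat,
    is_bigO
      (fun n => PI * landau n -
         (ln (16 * INR (n + 1)) + euler_gamma +
            sum_n_m (fun k => alpha k / INR (n + 1) ^ k) 1 m))
      (fun n => / INR (n + 1) ^ (m + 1)).

(* Main.v *)
Require Import Defs.
From Stdlib Require Import Reals Factorial Arith Lra Lia FunctionalExtensionality.
From Coquelicot Require Import Coquelicot.
Open Scope R_scope.

(** Let r_n be the ratio in the definition of G_n. The increments PI r_(n+1)^2 of
    PI G_n satisfy a first-order recurrence in N. Borel transformation
    N^-(k+1) -> t^k / k! turns it into a second-order differential equation, and
    gives, as formal power series,
      1 - sum_k alpha_(k+1) t^(k+1) / k!
        = (t/4) (1 / sinh (t/4) + 1 / cosh (t/4)) E(t)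
    where E is even. In the variable s given by t^2 = - 4 PI^2 s, s = x^2, E becomes
    the Legendre function y = P_(-1/2) (cos (PI x)), whose nearest singularity is
    the logarithm at s = 1. The terms with 1 / sinh and 1 / cosh give the even and
    the odd alpha_k; only 1 / cosh has a pole at s = 1, which is where the factor
    ln (2k + 1) comes from.

    Dividing the differential equation by the zero of sin (PI x) at x = 1, one gets
    a recurrence which makes 2 j y_j converge with error O(1/j). Its limit 4 / PI is
    found by letting x tend to 1 in y(x) = sum_n r_n^2 sin (PI x / 2)^(2n), since
    n r_n^2 tends to 1 / PI. *)

(** The hypothesis enters in two ways. Asymptotic expansions are unique, so the recurrence for the
    increments becomes an identity of formal series; and the limit of n r_n^2 is read off the same
    expansion, because ln (1 + 1/N) alone contributes to the order 1/N of PI r_(n+1)^2. Singularity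
    analysis is replaced by real estimates. A majorant of the Neumann series shows that the inverses
    of sin (PI x / 2) / (PI x / 2) and of cos (PI x / 2) / (1 - s) have geometrically decaying
    coefficients; a numerical bound on PI makes the majorant ratios less than 1. Multiplying by such
    series preserves polynomial decay. At x = 1 both y and the hypergeometric series diverge
    logarithmically. The comparison is therefore made between the fluxes sin (PI x / 2) cos (PI x /
    2) y'(x) / PI, which are power series with coefficients O(1/n^2), so that Abel summation
    applies. The two pairs (function, flux) solve the same linear system with the same values at
    0. *)

(** * Finite sums *)

Lemma sum_f_R0_exchange (f : nat -> nat -> R) (m n : nat) :
  sum_f_R0 (fun i => sum_f_R0 (fun j => f i j) n) m =
  sum_f_R0 (fun j => sum_f_R0 (fun i => f i j) m) n.
Proof.
  induction m as [|m IH]; simpl; [reflexivity|].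
  rewrite IH, <- plus_sum. reflexivity.
Qed.

Lemma sum_f_R0_scal (x : R) (f : nat -> R) (n : nat) :
  sum_f_R0 (fun i => x * f i) n = x * sum_f_R0 f n.
Proof.
  rewrite scal_sum. apply sum_eq. intros; ring.
Qed.

Lemma sum_f_R0_zero (f : nat -> R) (n : nat) :
  (forall i, (i <= n)%nat -> f i = 0) -> sum_f_R0 f n = 0.
Proof.
  intros H. rewrite (sum_eq f (fun _ => 0)) by assumption.
  rewrite sum_cte. ring.
Qed.

Lemma sum_f_R0_head (f : nat -> R) (n : nat) :
  (forall i, (i < n)%nat -> f (S i) = 0) -> sum_f_R0 f n = f 0%nat.
Proof.
  intros H. destruct n as [|n]; [reflexivity|].
  rewrite decomp_sum by lia. simpl pred.
  rewrite sum_f_R0_zero; [ring|]. intros; apply H; lia.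
Qed.

Lemma sum_f_R0_triangle (f : nat -> nat -> R) (n : nat) :
  sum_f_R0 (fun k => sum_f_R0 (fun i => f i (k - i)%nat) k) n =
  sum_f_R0 (fun i => sum_f_R0 (fun j => f i j) (n - i)) n.
Proof.
  induction n as [|n IH]; [reflexivity|].
  rewrite tech5, IH.
  rewrite (tech5 (fun i => sum_f_R0 (fun j => f i j) (S n - i))).
  rewrite (sum_eq (fun i => sum_f_R0 (fun j => f i j) (S n - i))
             (fun i => sum_f_R0 (fun j => f i j) (n - i) + f i (S n - i)%nat)).
  - rewrite plus_sum, tech5, Nat.sub_diag. simpl sum_f_R0. ring.
  - intros i Hi. rewrite Nat.sub_succ_l by exact Hi. reflexivity.
Qed.

Lemma sum_f_R0_rev (f : nat -> R) (n : nat) :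
  sum_f_R0 (fun i => f (n - i)%nat) n = sum_f_R0 f n.
Proof.
  induction n as [|n IH]; [reflexivity|].
  rewrite decomp_sum by lia. simpl pred. rewrite tech5, <- IH.
  rewrite Nat.sub_0_r.
  rewrite (sum_eq _ (fun i => f (n - i)%nat)); [ring|].
  intros; reflexivity.
Qed.

(** * Formal power series *)

Definition fps := nat -> R.

Definition fC (x : R) : fps := fun n => match n with O => x | S _ => 0 end.
Definition fX : fps := fun n => match n with 1%nat => 1 | _ => 0 end.
Definition fadd (f g : fps) : fps := fun n => f n + g n.
Definition fopp (f : fps) : fps := fun n => - f n.
Definition fsub (f g : fps) : fps := fun n => f n - g n.
Definition fmul (f g : fps) : fps :=
  fun n => sum_f_R0 (fun k => f k * g (n - k)%nat) n.

Declare Scope fps_scope.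
Delimit Scope fps_scope with fps.
Bind Scope fps_scope with fps.
Infix "+" := fadd : fps_scope.
Infix "-" := fsub : fps_scope.
Infix "*" := fmul : fps_scope.
Notation "- f" := (fopp f) : fps_scope.

Lemma fC_mulE (x : R) (f : fps) (n : nat) : (fC x * f)%fps n = x * f n.
Proof.
  unfold fmul. rewrite sum_f_R0_head.
  - simpl. rewrite Nat.sub_0_r. reflexivity.
  - intros; simpl; ring.
Qed.

Lemma fX_mulE (f : fps) (n : nat) : (fX * f)%fps (S n) = f n.
Proof.
  unfold fmul. rewrite decomp_sum by lia. simpl pred.
  rewrite sum_f_R0_head.
  - simpl. rewrite Nat.sub_0_r. ring.
  - intros; simpl; ring.
Qed.

Lemma fX_mulE0 (f : fps) : (fX * f)%fps 0%nat = 0.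
Proof. unfold fmul; simpl; ring. Qed.

Lemma fmulC (f g : fps) : (f * g)%fps = (g * f)%fps.
Proof.
  extensionality n. unfold fmul.
  rewrite <- (sum_f_R0_rev (fun k => g k * f (n - k)%nat)).
  apply sum_eq. intros i Hi. replace (n - (n - i))%nat with i by lia. ring.
Qed.

Lemma fmulA (f g h : fps) : (f * (g * h))%fps = (f * g * h)%fps.
Proof.
  extensionality n. unfold fmul.
  rewrite (sum_eq (fun k => sum_f_R0 (fun i => f i * g (k - i)%nat) k * h (n - k)%nat)
             (fun k => sum_f_R0 (fun i =>
                (fun i j => f i * (g j * h (n - i - j)%nat)) i (k - i)%nat) k)).
  - rewrite (sum_f_R0_triangle (fun i j => f i * (g j * h (n - i - j)%nat))).
    apply sum_eq. intros i Hi.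
    rewrite <- sum_f_R0_scal. reflexivity.
  - intros k Hk. rewrite Rmult_comm, <- sum_f_R0_scal. apply sum_eq. intros i Hi.
    replace (n - i - (k - i))%nat with (n - k)%nat by lia. ring.
Qed.

Lemma fmul_addl (f g h : fps) : ((f + g) * h)%fps = (f * h + g * h)%fps.
Proof.
  extensionality n. unfold fmul, fadd. rewrite <- plus_sum.
  apply sum_eq. intros; ring.
Qed.

Lemma fps_ring : ring_theory (fC 0) (fC 1) fadd fmul fsub fopp eq.
Proof.
  split.
  - intros f. extensionality n. unfold fadd. destruct n; simpl; ring.
  - intros f g. extensionality n. unfold fadd. ring.
  - intros f g h. extensionality n. unfold fadd. ring.
  - intros f. extensionality n. rewrite fC_mulE. ring.
  - exact fmulC.
  - exact fmulA.
  - exact fmul_addl.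
  - intros f g. extensionality n. unfold fsub, fadd, fopp. ring.
  - intros f. extensionality n. unfold fadd, fopp. destruct n; simpl; ring.
Qed.

Add Ring fps_ring_inst : fps_ring.

Lemma fC_mul (x y : R) : (fC x * fC y)%fps = fC (x * y).
Proof. extensionality n. rewrite fC_mulE. destruct n; simpl; ring. Qed.

Lemma fC_add (x y : R) : (fC x + fC y)%fps = fC (x + y).
Proof. extensionality n. unfold fadd. destruct n; simpl; ring. Qed.

Lemma fmul_0 (f g : fps) : (f * g)%fps 0%nat = f 0%nat * g 0%nat.
Proof. reflexivity. Qed.

Lemma fX_cancel (f g : fps) : (fX * f)%fps = (fX * g)%fps -> f = g.
Proof.
  intros H. extensionality n. rewrite <- (fX_mulE f), H. apply fX_mulE.
Qed.

(** The Euler operator t d/dt. Unlike d/dt it shifts no index, so it respects the splitting into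
    even and odd parts. *)
Definition theta (f : fps) : fps := fun n => INR n * f n.

Lemma theta_add (f g : fps) : theta (f + g)%fps = (theta f + theta g)%fps.
Proof. extensionality n. unfold theta, fadd. ring. Qed.

Lemma theta_sub (f g : fps) : theta (f - g)%fps = (theta f - theta g)%fps.
Proof. extensionality n. unfold theta, fsub. ring. Qed.

Lemma theta_opp (f : fps) : theta (- f)%fps = (- theta f)%fps.
Proof. extensionality n. unfold theta, fopp. ring. Qed.

Lemma theta_mul (f g : fps) :
  theta (f * g)%fps = (theta f * g + f * theta g)%fps.
Proof.
  extensionality n. unfold theta, fadd, fmul.
  rewrite <- plus_sum, <- sum_f_R0_scal. apply sum_eq. intros i Hi.
  rewrite minus_INR by exact Hi. ring.
Qed.

Lemma theta_C (x : R) : theta (fC x) = fC 0.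
Proof. extensionality n. unfold theta. destruct n; simpl; ring. Qed.

Lemma theta_X : theta fX = fX.
Proof. extensionality n. unfold theta. destruct n as [|[|n]]; simpl; ring. Qed.

(** Replaces uniqueness for differential equations: identities between exponentials are checked by
    applying [theta] and comparing constant terms. *)
Lemma theta_eq0 (f : fps) : theta f = fC 0 -> f = fC (f 0%nat).
Proof.
  intros H. extensionality n. destruct n as [|n]; [reflexivity|].
  pose proof (f_equal (fun h => h (S n)) H) as Hn. unfold theta in Hn.
  cbn [fC] in *. apply Rmult_integral in Hn. destruct Hn as [Hn|Hn]; [|exact Hn].
  exfalso. revert Hn. apply not_0_INR. lia.
Qed.

Definition fexp (x : R) : fps := fun n => x ^ n / INR (fact n).

Lemma theta_exp (x : R) : theta (fexp x) = (fC x * fX * fexp x)%fps.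
Proof.
  extensionality n. unfold theta. rewrite <- fmulA, fC_mulE.
  destruct n as [|n].
  - rewrite fX_mulE0. simpl. ring.
  - rewrite fX_mulE. unfold fexp. rewrite fact_simpl, mult_INR. simpl pow.
    field. split; [apply INR_fact_neq_0 | apply not_0_INR; lia].
Qed.

Lemma fexp_0 (x : R) : fexp x 0%nat = 1.
Proof. unfold fexp; simpl; field. Qed.

(* The inverse is given by the Neumann series: only finitely many powers
    of [1 - f] reach a given coefficient when [f 0 = 1]. *)
Fixpoint fpow (f : fps) (j : nat) : fps :=
  match j with O => fC 1 | S i => (f * fpow f i)%fps end.

Definition finv (f : fps) : fps :=
  fun n => sum_f_R0 (fun j => fpow (fC 1 - f)%fps j n) n.

Lemma fpow_low (f : fps) (j n : nat) :
  f 0%nat = 0 -> (n < j)%nat -> fpow f j n = 0.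
Proof.
  intros H0. revert n. induction j as [|j IH]; intros n Hn; [lia|].
  simpl. unfold fmul. apply sum_f_R0_zero. intros [|i] Hi.
  - rewrite H0; ring.
  - rewrite IH by lia. ring.
Qed.

Lemma finv_mul (f : fps) : f 0%nat = 1 -> (f * finv f)%fps = fC 1.
Proof.
  intros H0. set (g := (fC 1 - f)%fps).
  assert (Hg : g 0%nat = 0) by (unfold g, fsub; simpl; lra).
  (* Powers of g beyond the n-th do not reach coefficient n, so all coefficients up to n can be
     truncated at one common level, where the geometric sum telescopes. *)
  assert (Hstab : forall d n, finv f n = sum_f_R0 (fun j => fpow g j n) (n + d)).
  { induction d as [|d IH]; intros n.
    - rewrite Nat.add_0_r. reflexivity.
    - rewrite Nat.add_succ_r, tech5, <- IH, fpow_low by (assumption || lia). ring. }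
  assert (Htel : forall m, (f * (fun n => sum_f_R0 (fun j => fpow g j n) m))%fps =
                 (fC 1 - fpow g (S m))%fps).
  { induction m as [|m IH].
    - change (f * fpow g 0 = fC 1 - g * fC 1)%fps. unfold g. simpl fpow. ring.
    - change (f * ((fun n => sum_f_R0 (fun j => fpow g j n) m) + fpow g (S m)) =
              fC 1 - g * fpow g (S m))%fps.
      transitivity (f * (fun n => sum_f_R0 (fun j => fpow g j n) m) + f * fpow g (S m))%fps;
        [ring|].
      rewrite IH. replace f with (fC 1 - g)%fps at 1 by (unfold g; ring). ring. }
  extensionality n.
  transitivity ((f * (fun i => sum_f_R0 (fun j => fpow g j i) n))%fps n).
  - unfold fmul. apply sum_eq. intros i Hi. f_equal.
    rewrite (Hstab i). replace (n - i + i)%nat with n by lia. reflexivity.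
  - rewrite Htel. unfold fsub. rewrite fpow_low by (assumption || lia). ring.
Qed.

(** Majorant method: f is compared with 1 - K q t / (1 - q t), whose inverse (1 - q t) / (1 - q (1 +
    K) t) has growth ratio q (1 + K). Later constants are chosen to make this ratio less than 1. *)
Lemma finv_geometric (f : fps) (K q : R) :
  0 <= K -> 0 <= q -> f 0%nat = 1 ->
  (forall n, Rabs (f (S n)) <= K * q ^ S n) ->
  forall n, Rabs (finv f n) <= (q * (1 + K)) ^ n.
Proof.
  intros HK Hq H0 Hf.
  pose proof (finv_mul f H0) as Hinv.
  set (Q := q * (1 + K)).
  assert (HQ : 0 <= Q) by (unfold Q; nra).
  assert (Hsum : forall n, sum_f_R0 (fun k => K * q ^ S k * Q ^ (n - k)) n =
                 Q ^ S n - q ^ S n).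
  { induction n as [|n IH].
    - unfold Q. simpl. ring.
    - rewrite tech5, Nat.sub_diag.
      rewrite (sum_eq _ (fun k => Q * (K * q ^ S k * Q ^ (n - k)))).
      2: { intros i Hi. rewrite Nat.sub_succ_l by exact Hi. simpl. ring. }
      rewrite sum_f_R0_scal, IH. unfold Q. simpl. ring. }
  apply (well_founded_induction Wf_nat.lt_wf). intros n IH.
  pose proof (f_equal (fun h => h n) Hinv) as Hn. destruct n as [|n].
  - rewrite fmul_0, H0 in Hn. cbn [fC] in Hn. rewrite pow_O.
    replace (finv f 0%nat) with 1 by lra. rewrite Rabs_R1. lra.
  - unfold fmul in Hn. rewrite decomp_sum in Hn by lia.
    simpl pred in Hn. rewrite H0, Nat.sub_0_r in Hn. cbn [fC] in Hn.
    replace (finv f (S n)) with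
      (- sum_f_R0 (fun k => f (S k) * finv f (S n - S k)%nat) n) by lra.
    rewrite Rabs_Ropp. eapply Rle_trans; [apply Rsum_abs|].
    eapply Rle_trans; [apply (sum_Rle _ (fun k => K * q ^ S k * Q ^ (n - k)))|].
    + intros k Hk. rewrite Rabs_mult.
      apply Rmult_le_compat; try apply Rabs_pos; [apply Hf|].
      apply IH. simpl. lia.
    + rewrite Hsum. assert (0 <= q ^ S n) by (apply pow_le; exact Hq). lra.
Qed.

(** * Expansions in powers of [1 / N] *)

Definition recipN (n : nat) : R := / INR (n + 1).

Definition asym (f : nat -> R) (c : fps) : Prop :=
  forall m, exists C, eventually (fun n =>
    Rabs (f n - sum_f_R0 (fun k => c k * recipN n ^ k) m) <= C * recipN n ^ S m).

Lemma recipN_pos (n : nat) : 0 < recipN n.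
Proof. apply Rinv_0_lt_compat, lt_0_INR. lia. Qed.

Lemma recipN_le1 (n : nat) : recipN n <= 1.
Proof.
  unfold recipN. rewrite <- Rinv_1. apply Rinv_le_contravar; [lra|].
  rewrite plus_INR. simpl. pose proof (pos_INR n). lra.
Qed.

Lemma recipN_shift (n : nat) : recipN (S n) = recipN n / (1 + recipN n).
Proof.
  unfold recipN. replace (S n + 1)%nat with (S (n + 1)) by lia.
  rewrite S_INR. assert (0 < INR (n + 1)) by (apply lt_0_INR; lia).
  field. lra.
Qed.

Lemma recipN_small (e : R) : 0 < e -> eventually (fun n => recipN n < e).
Proof.
  intros He. destruct (archimed_cor1 e He) as [M [HM HM0]].
  exists M. intros n Hn. eapply Rle_lt_trans; [|exact HM].
  unfold recipN. apply Rinv_le_contravar; [apply lt_0_INR; lia | apply le_INR; lia].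
Qed.

Lemma asym_ext (f g : nat -> R) (c : fps) :
  (forall n, f n = g n) -> asym f c -> asym g c.
Proof.
  intros E H m. destruct (H m) as [C HC]. exists C. revert HC. apply filter_imp.
  intros n. rewrite E. trivial.
Qed.

Lemma asym_add (f g : nat -> R) (c d : fps) :
  asym f c -> asym g d -> asym (fun n => f n + g n) (c + d)%fps.
Proof.
  intros Hf Hg m. destruct (Hf m) as [C HC], (Hg m) as [D HD].
  exists (C + D). generalize (filter_and _ _ HC HD). apply filter_imp.
  intros n [H1 H2]. unfold fadd.
  rewrite (sum_eq _ (fun k => c k * recipN n ^ k + d k * recipN n ^ k))
    by (intros; ring).
  rewrite plus_sum.
  replace (f n + g n - _) with
    ((f n - sum_f_R0 (fun k => c k * recipN n ^ k) m) +
     (g n - sum_f_R0 (fun k => d k * recipN n ^ k) m)) by ring.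
  eapply Rle_trans; [apply Rabs_triang|]. lra.
Qed.

Lemma asym_scal (x : R) (f : nat -> R) (c : fps) :
  asym f c -> asym (fun n => x * f n) (fC x * c)%fps.
Proof.
  intros Hf m. destruct (Hf m) as [C HC]. exists (Rabs x * C).
  revert HC. apply filter_imp. intros n H.
  rewrite (sum_eq _ (fun k => x * (c k * recipN n ^ k)))
    by (intros; rewrite fC_mulE; ring).
  rewrite sum_f_R0_scal, <- Rmult_minus_distr_l, Rabs_mult, Rmult_assoc.
  apply Rmult_le_compat_l; [apply Rabs_pos | exact H].
Qed.

Lemma asym_mulX (f : nat -> R) (c : fps) :
  asym f c -> asym (fun n => recipN n * f n) (fX * c)%fps.
Proof.
  intros Hf [|m].
  (* At order 0 the product has no constant term, and boundedness of f is enough. *)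
  - destruct (Hf 0%nat) as [C HC]. exists (Rabs (c 0%nat) + Rabs C).
    revert HC. apply filter_imp. intros n H. simpl in *.
    rewrite fX_mulE0. pose proof (recipN_pos n). pose proof (recipN_le1 n).
    rewrite Rmult_0_l, Rminus_0_r, Rabs_mult, (Rabs_right (recipN n)) by lra.
    rewrite Rmult_1_r in *. rewrite Rmult_comm. apply Rmult_le_compat_r; [lra|].
    replace (f n) with (c 0%nat + (f n - c 0%nat)) by ring.
    eapply Rle_trans; [apply Rabs_triang|]. apply Rplus_le_compat_l.
    eapply Rle_trans; [exact H|]. pose proof (Rle_abs C). pose proof (Rabs_pos C). nra.
  - destruct (Hf m) as [C HC]. exists C. revert HC. apply filter_imp. intros n H.
    rewrite decomp_sum by lia. simpl pred. rewrite fX_mulE0.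
    rewrite (sum_eq _ (fun k => recipN n * (c k * recipN n ^ k)))
      by (intros; rewrite fX_mulE; simpl; ring).
    rewrite sum_f_R0_scal, Rmult_0_l, Rplus_0_l, <- Rmult_minus_distr_l, Rabs_mult.
    pose proof (recipN_pos n). rewrite (Rabs_right (recipN n)) by lra.
    change (recipN n ^ S (S m)) with (recipN n * recipN n ^ S m).
    nra.
Qed.

(** At the first index m where c and d could differ, subtracting the two estimates and dividing by
    N^-m bounds their difference by (C + D) / N. *)
Lemma asym_unique (f : nat -> R) (c d : fps) : asym f c -> asym f d -> c = d.
Proof.
  intros Hc Hd. extensionality m. apply (well_founded_induction Wf_nat.lt_wf) with (a := m).
  clear m. intros m IH. apply Rminus_diag_uniq.
  destruct (Hc m) as [C HC], (Hd m) as [D HD].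
  destruct (Req_dec (c m - d m) 0) as [E|E]; [exact E|exfalso].
  assert (Hpos : 0 < Rabs (c m - d m)) by (apply Rabs_pos_lt; exact E).
  (* Threshold below which (C + D) / N is less than the supposed difference; the 1 avoids a zero
     denominator. *)
  assert (Hq : 0 < Rabs (c m - d m) / (1 + Rabs (C + D))).
  { apply Rdiv_lt_0_compat; [exact Hpos|]. pose proof (Rabs_pos (C + D)). lra. }
  generalize (filter_and _ _ (filter_and _ _ HC HD) (recipN_small _ Hq)).
  intros [n Hn]. destruct (Hn n (le_n n)) as [[H1 H2] H3]. clear Hn.
  pose proof (recipN_pos n) as HX. set (x := recipN n) in *.
  assert (Hdiff : sum_f_R0 (fun k => d k * x ^ k) m - sum_f_R0 (fun k => c k * x ^ k) m =
                  (d m - c m) * x ^ m).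
  { destruct m as [|m]; [simpl; ring|]. rewrite !tech5.
    rewrite (sum_eq (fun k => d k * x ^ k) (fun k => c k * x ^ k)); [ring|].
    intros i Hi. rewrite IH by lia. reflexivity. }
  assert (Hb : Rabs (c m - d m) * x ^ m <= (C + D) * x ^ S m).
  { assert (0 < x ^ m) by (apply pow_lt; exact HX).
    rewrite <- (Rabs_right (x ^ m)) at 1 by lra. rewrite <- Rabs_mult.
    replace ((c m - d m) * x ^ m) with
      ((f n - sum_f_R0 (fun k => d k * x ^ k) m) -
       (f n - sum_f_R0 (fun k => c k * x ^ k) m)) by lra.
    eapply Rle_trans; [apply Rabs_triang|]. rewrite Rabs_Ropp. lra. }
  assert (Hxm : 0 < x ^ m) by (apply pow_lt; exact HX).
  simpl in Hb.
  assert (Hc2 : Rabs (c m - d m) <= (C + D) * x).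
  { apply (Rmult_le_reg_r (x ^ m)); [exact Hxm|]. lra. }
  pose proof (Rle_abs (C + D)). pose proof (Rabs_pos (C + D)).
  apply (Rmult_lt_compat_r (1 + Rabs (C + D))) in H3; [|lra].
  unfold Rdiv in H3. rewrite Rmult_assoc, Rinv_l, Rmult_1_r in H3 by lra.
  nra.
Qed.

(* [(N + 1)^-(k + 1)] is the sum over [n] of [shift_coef n k * N^-(n + 1)]. *)
Fixpoint shift_coef (n k : nat) : R :=
  match n, k with
  | O, O => 1
  | O, S _ => 0
  | S n', O => - shift_coef n' 0
  | S n', S k' => shift_coef n' k' - shift_coef n' k
  end.

Lemma shift_coef_high (n k : nat) : (n < k)%nat -> shift_coef n k = 0.
Proof.
  revert k. induction n as [|n IH]; intros [|k] Hk; try lia; [reflexivity|].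
  simpl. rewrite !IH by lia. ring.
Qed.

(** The closed form (-1)^j binomial (k + j, k), written without division; its factorials are the
    ones that the Borel transform divides by. *)
Lemma shift_coef_fact (k j : nat) :
  shift_coef (k + j) k * INR (fact k) * INR (fact j) =
  (-1) ^ j * INR (fact (k + j)).
Proof.
  revert j. induction k as [|k IHk]; intros j.
  - induction j as [|j IHj]; [simpl; ring|].
    rewrite Nat.add_0_l in *. rewrite fact_simpl, mult_INR.
    change (shift_coef (S j) 0) with (- shift_coef j 0).
    transitivity (- (shift_coef j 0 * INR (fact 0) * INR (fact j)) * INR (S j)); [ring|].
    rewrite IHj. simpl pow. ring.
  - induction j as [|j IHj].
    + rewrite Nat.add_0_r. simpl shift_coef. rewrite (shift_coef_high k (S k)) by lia.
      specialize (IHk 0%nat). rewrite Nat.add_0_r in IHk.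
      rewrite fact_simpl, mult_INR.
      transitivity (INR (S k) * (shift_coef k k * INR (fact k) * INR (fact 0))); [ring|].
      rewrite IHk. ring.
    + specialize (IHk (S j)).
      replace (S k + S j)%nat with (S (k + S j)) by lia.
      replace (S k + j)%nat with (k + S j)%nat in IHj by lia.
      change (shift_coef (S (k + S j)) (S k)) with
        (shift_coef (k + S j) k - shift_coef (k + S j) (S k)).
      rewrite (fact_simpl (k + S j)), mult_INR.
      transitivity ((shift_coef (k + S j) k * INR (fact k) * INR (fact (S j))) * INR (S k)
        - (shift_coef (k + S j) (S k) * INR (fact (S k)) * INR (fact j)) * INR (S j)).
      * rewrite (fact_simpl k), (fact_simpl j), !mult_INR. ring.
      * rewrite IHk, IHj. replace (S (k + S j)) with (S k + S j)%nat by lia.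
        rewrite plus_INR. simpl pow. ring.
Qed.

(** Pascal's rule for [shift_coef] says that column k + 1 is column k times x / (1 + x). Truncation
    at m leaves one boundary term. *)
Lemma shift_coef_sum (k m : nat) (x : R) :
  (1 + x) * sum_f_R0 (fun n => shift_coef n (S k) * x ^ S n) m =
  x * sum_f_R0 (fun n => shift_coef n k * x ^ S n) m +
  (shift_coef m (S k) - shift_coef m k) * x ^ S (S m).
Proof.
  induction m as [|m IH].
  - simpl. destruct k; ring.
  - rewrite !tech5, Rmult_plus_distr_l, IH.
    change (shift_coef (S m) (S k)) with (shift_coef m k - shift_coef m (S k)).
    simpl pow. ring.
Qed.

Lemma shift_coef_sum0 (m : nat) (x : R) :
  (1 + x) * sum_f_R0 (fun n => shift_coef n 0 * x ^ S n) m =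
  x + shift_coef m 0 * x ^ S (S m).
Proof.
  induction m as [|m IH].
  - simpl. ring.
  - rewrite !tech5, Rmult_plus_distr_l, IH.
    change (shift_coef (S m) 0) with (- shift_coef m 0).
    simpl pow. ring.
Qed.

(** With x = 1/N, the fraction x / (1 + x) is 1 / (N + 1). The estimate holds for every x >= 0, so C
    does not depend on N. *)
Lemma shift_remainder (k m : nat) : exists C, forall x, 0 <= x ->
  Rabs ((x / (1 + x)) ^ S k - sum_f_R0 (fun n => shift_coef n k * x ^ S n) m) <=
  C * x ^ S (S m).
Proof.
  assert (Hdiv : forall x r b, 0 <= x -> Rabs ((1 + x) * r) <= b -> Rabs r <= b).
  { intros x r b Hx H. rewrite Rabs_mult, Rabs_right in H by lra.
    pose proof (Rabs_pos r). nra. }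
  induction k as [|k [C IH]].
  - exists (Rabs (shift_coef m 0)). intros x Hx. apply (Hdiv x); [exact Hx|].
    rewrite Rmult_minus_distr_l, shift_coef_sum0, pow_1.
    replace ((1 + x) * (x / (1 + x)) - _) with (- (shift_coef m 0 * x ^ S (S m)))
      by (field; lra).
    rewrite Rabs_Ropp, Rabs_mult, (Rabs_right (x ^ _)); [lra|].
    apply Rle_ge, pow_le, Hx.
  - exists (Rabs C * 1 + Rabs (shift_coef m (S k) - shift_coef m k)). intros x Hx.
    assert (Hp : 0 <= x ^ S (S m)) by (apply pow_le, Hx).
    set (r := (x / (1 + x)) ^ S k - sum_f_R0 (fun n => shift_coef n k * x ^ S n) m).
    assert (Hy : 0 <= x / (1 + x) <= 1).
    { split; [apply Rdiv_le_0_compat; lra|]. apply (Rmult_le_reg_r (1 + x)); [lra|].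
      unfold Rdiv. rewrite Rmult_assoc, Rinv_l; lra. }
    (* The remainder for k + 1 is x / (1 + x) times the remainder for k, minus the boundary term of
       [shift_coef_sum] divided by 1 + x. *)
    replace ((x / (1 + x)) ^ S (S k) -
      sum_f_R0 (fun n => shift_coef n (S k) * x ^ S n) m) with
      (x / (1 + x) * r -
       / (1 + x) * ((shift_coef m (S k) - shift_coef m k) * x ^ S (S m))).
    + eapply Rle_trans; [apply Rabs_triang|]. rewrite Rabs_Ropp, !Rabs_mult.
      rewrite (Rabs_right (x / (1 + x))), (Rabs_right (/ (1 + x))), (Rabs_right (x ^ _)); try lra.
      2: { apply Rle_ge, Rlt_le, Rinv_0_lt_compat. lra. }
      assert (Hi : / (1 + x) <= 1).
      { rewrite <- Rinv_1. apply Rinv_le_contravar; lra. }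
      assert (0 < / (1 + x)) by (apply Rinv_0_lt_compat; lra).
      rewrite Rmult_plus_distr_r. apply Rplus_le_compat.
      * specialize (IH x Hx). fold r in IH. pose proof (Rabs_pos r).
        pose proof (Rle_abs C). nra.
      * pose proof (Rabs_pos (shift_coef m (S k) - shift_coef m k)).
        assert (0 <= Rabs (shift_coef m (S k) - shift_coef m k) * x ^ S (S m)) by nra.
        nra.
    + unfold r. apply (Rmult_eq_reg_l (1 + x)); [|lra].
      rewrite (Rmult_minus_distr_l (1 + x) ((x / (1 + x)) ^ S (S k))), shift_coef_sum.
      simpl pow. field. lra.
Qed.

(** Re-expansion of a series in 1 / (N + 1) in powers of 1/N; the constant term is unaffected. *)
Definition fshift (c : fps) : fps := fun n =>
  match n with
  | O => c 0%nat
  | S n' => sum_f_R0 (fun k => shift_coef n' k * c (S k)) n'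
  end.

Lemma asym_shift (f : nat -> R) (c : fps) :
  asym f c -> asym (fun n => f (S n)) (fshift c).
Proof.
  intros Hf m.
  (* Error of re-expanding the terms of degree 1 to p + 1. Degrees are one more than indices, so
     [pred m] cuts at degree m when m > 0. *)
  assert (Hlin : forall p, exists C, forall x, 0 <= x ->
    Rabs (sum_f_R0 (fun k => c (S k) * (x / (1 + x)) ^ S k) p -
          sum_f_R0 (fun k => c (S k) *
            sum_f_R0 (fun n => shift_coef n k * x ^ S n) (pred m)) p) <=
    C * x ^ S (S (pred m))).
  { induction p as [|p [C IH]].
    - destruct (shift_remainder 0 (pred m)) as [C HC]. exists (Rabs (c 1%nat) * C).
      intros x Hx. cbn [sum_f_R0]. rewrite <- Rmult_minus_distr_l, Rabs_mult, Rmult_assoc.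
      apply Rmult_le_compat_l; [apply Rabs_pos | exact (HC x Hx)].
    - destruct (shift_remainder (S p) (pred m)) as [D HD].
      exists (C + Rabs (c (S (S p))) * D). intros x Hx. rewrite !tech5.
      specialize (IH x Hx). specialize (HD x Hx).
      match goal with |- Rabs (?a + ?b * ?e - (?a' + ?b * ?e')) <= _ =>
        replace (a + b * e - (a' + b * e')) with ((a - a') + b * (e - e')) by ring end.
      eapply Rle_trans; [apply Rabs_triang|]. rewrite Rabs_mult, Rmult_plus_distr_r.
      apply Rplus_le_compat; [exact IH|]. rewrite Rmult_assoc.
      apply Rmult_le_compat_l; [apply Rabs_pos | exact HD]. }
  destruct (Hf m) as [C [n0 HC]].
  (* The remainder given at N + 1 has to be expressed at N. *)
  assert (Hmono : forall n, Rabs C * recipN (S n) ^ S m <= Rabs C * recipN n ^ S m).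
  { intros n. apply Rmult_le_compat_l; [apply Rabs_pos|]. apply pow_incr.
    split; [apply Rlt_le, recipN_pos|]. rewrite recipN_shift.
    pose proof (recipN_pos n). apply (Rmult_le_reg_r (1 + recipN n)); [lra|].
    unfold Rdiv. rewrite Rmult_assoc, Rinv_l by lra. nra. }
  destruct m as [|m].
  - exists (Rabs C). exists n0. intros n Hn.
    eapply Rle_trans; [|apply Hmono]. specialize (HC (S n) ltac:(lia)).
    simpl in *. pose proof (Rle_abs C). pose proof (recipN_pos (S n)). nra.
  - destruct (Hlin m) as [D HD]. exists (Rabs C + D). exists n0. intros n Hn.
    specialize (HC (S n) ltac:(lia)). specialize (HD (recipN n) (Rlt_le _ _ (recipN_pos n))).
    rewrite <- recipN_shift in HD. simpl pred in HD.
    specialize (Hmono n). rewrite Rmult_plus_distr_r.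
    rewrite decomp_sum in HC by lia. simpl pred in HC.
    rewrite decomp_sum by lia. simpl pred.
    replace (sum_f_R0 (fun i => fshift c (S i) * recipN n ^ S i) m) with
      (sum_f_R0 (fun k => c (S k) *
        sum_f_R0 (fun n0 => shift_coef n0 k * recipN n ^ S n0) m) m).
    + match type of HC with Rabs (?F - (?z + ?s)) <= _ =>
      match type of HD with Rabs (s - ?s') <= _ =>
        replace (F - (fshift c 0%nat * recipN n ^ 0 + s')) with
          ((F - (z + s)) + (s - s')) by (simpl; ring) end end.
      eapply Rle_trans; [apply Rabs_triang|]. apply Rplus_le_compat; [|exact HD].
      eapply Rle_trans; [exact HC|]. eapply Rle_trans; [|exact Hmono].
      apply Rmult_le_compat_r; [apply pow_le, Rlt_le, recipN_pos | apply Rle_abs].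
    + rewrite (sum_eq _ (fun k => sum_f_R0 (fun i =>
        c (S k) * (shift_coef i k * recipN n ^ S i)) m))
        by (intros; rewrite sum_f_R0_scal; reflexivity).
      rewrite sum_f_R0_exchange. apply sum_eq. intros i Hi. cbn [fshift].
      rewrite (Rmult_comm (sum_f_R0 _ _)), <- sum_f_R0_scal.
      (* The inner sum may stop at i, because [shift_coef i k] vanishes for k > i. *)
      replace m with (i + (m - i))%nat by lia.
      induction (m - i)%nat as [|d IHd].
      * rewrite Nat.add_0_r. apply sum_eq. intros; ring.
      * rewrite Nat.add_succ_r, tech5, IHd, shift_coef_high by lia. ring.
Qed.

Lemma is_derive_monomial (a t : R) (p : nat) :
  is_derive (fun t => a * t ^ S p) t (a * (INR (S p) * t ^ p)).
Proof. auto_derive; [trivial|]. rewrite S_INR. destruct p; simpl; ring. Qed.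

(** The derivative of the difference is the geometric tail (-t)^(m+1) / (1 + t), at most x^(m+1) in
    absolute value on [0, x]; the mean value theorem supplies one more factor x. *)
Lemma ln_remainder (m : nat) (x : R) : 0 <= x ->
  Rabs (ln (1 + x) - sum_f_R0 (fun n => (-1) ^ n / INR (S n) * x ^ S n) m) <=
  x ^ S (S m).
Proof.
  intros Hx.
  assert (Hd : forall t, 0 <= t -> is_derive (fun t => ln (1 + t) -
     sum_f_R0 (fun n => (-1) ^ n / INR (S n) * t ^ S n) m) t
     (/ (1 + t) - sum_f_R0 (fun n => (- t) ^ n) m)).
  { intros t Ht. apply (is_derive_minus (V := R_NormedModule)).
    - auto_derive; [lra|]. field. lra.
    - clear. induction m as [|m IH].
      + simpl. auto_derive; [trivial|]. field.
      + cbn [sum_f_R0]. apply (is_derive_plus (V := R_NormedModule)); [exact IH|].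
        replace ((- t) ^ S m) with ((-1) ^ S m / INR (S (S m)) * (INR (S (S m)) * t ^ S m)).
        * apply is_derive_monomial.
        * replace ((- t) ^ S m) with ((-1) ^ S m * t ^ S m).
          -- field. apply not_0_INR. lia.
          -- rewrite <- Rpow_mult_distr. f_equal. ring. }
  destruct (MVT_gen (fun t => ln (1 + t) -
     sum_f_R0 (fun n => (-1) ^ n / INR (S n) * t ^ S n) m) 0 x
     (fun t => / (1 + t) - sum_f_R0 (fun n => (- t) ^ n) m)) as [c [Hc E]].
  - intros t Ht. rewrite Rmin_left in Ht by lra. apply Hd; lra.
  - intros t Ht. rewrite Rmin_left in Ht by lra.
    apply derivable_continuous_pt, ex_derive_Reals_0. eexists. apply Hd; lra.
  - rewrite Rmin_left, Rmax_right in Hc by lra. simpl in E.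
    rewrite Rplus_0_r, ln_1 in E.
    rewrite (sum_f_R0_zero (fun n => (-1) ^ n / INR (S n) * (0 * 0 ^ n))) in E
      by (intros; ring).
    rewrite !Rminus_0_r in E.
    change (ln (1 + x) - sum_f_R0 (fun n => (-1) ^ n / INR (S n) * x ^ S n) m =
            (/ (1 + c) - sum_f_R0 (fun n => (- c) ^ n) m) * x) in E.
    rewrite E, Rabs_mult, (Rabs_right x) by lra.
    change (x ^ S (S m)) with (x * x ^ S m). rewrite Rmult_comm.
    apply Rmult_le_compat_l; [exact Hx|].
    replace (/ (1 + c) - sum_f_R0 (fun n => (- c) ^ n) m) with
      ((- c) ^ S m * / (1 + c)).
    + rewrite Rabs_mult, <- RPow_abs, Rabs_Ropp, Rabs_right, Rabs_right; try lra.
      * assert (/ (1 + c) <= 1) by (rewrite <- Rinv_1; apply Rinv_le_contravar; lra).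
        assert (0 < / (1 + c)) by (apply Rinv_0_lt_compat; lra).
        assert (c ^ S m <= x ^ S m) by (apply pow_incr; lra).
        assert (0 <= c ^ S m) by (apply pow_le; lra). nra.
      * apply Rle_ge, Rlt_le, Rinv_0_lt_compat. lra.
    + rewrite tech3 by lra. field. lra.
Qed.

Definition fln : fps := fun n => match n with O => 0 | S i => (-1) ^ i / INR n end.

Lemma asym_ln : asym (fun n => ln (1 + recipN n)) fln.
Proof.
  intros [|m]; exists 1; exists 0%nat; intros n _;
    pose proof (recipN_pos n) as Hx; set (x := recipN n) in *.
  - simpl. rewrite Rmult_0_l, Rminus_0_r, Rmult_1_r, Rmult_1_l.
    assert (0 < ln (1 + x)) by (rewrite <- ln_1; apply ln_increasing; lra).
    rewrite Rabs_right by lra.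
    pose proof (exp_ineq1 x ltac:(lra)).
    rewrite <- (ln_exp x) at 2. apply Rlt_le, ln_increasing; lra.
  - rewrite decomp_sum by lia. cbn [fln pred]. rewrite Rmult_0_l, Rplus_0_l, Rmult_1_l.
    apply ln_remainder. lra.
Qed.

(** * Borel transform of the expansion *)

(* The constant term is dropped; [N^-(k+1)] goes to [t^k / k!]. *)
Definition borel (c : fps) : fps := fun n => c (S n) / INR (fact n).

(** Formally N^-(k+1) is the Laplace integral of t^k / k! against e^(-N t), so replacing N by N + 1
    inserts e^(-t). On coefficients, the binomials of [fshift] become a convolution with (-1)^j /
    j!. *)
Lemma borel_shift (c : fps) : borel (fshift c) = (borel c * fexp (-1))%fps.
Proof.
  extensionality n. unfold borel, fmul, fexp, Rdiv. cbn [fshift].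
  rewrite Rmult_comm, <- sum_f_R0_scal. apply sum_eq. intros k Hk.
  pose proof (shift_coef_fact k (n - k)) as H.
  replace (k + (n - k))%nat with n in H by lia.
  pose proof (INR_fact_neq_0 k). pose proof (INR_fact_neq_0 n).
  pose proof (INR_fact_neq_0 (n - k)).
  replace (shift_coef n k) with
    ((-1) ^ (n - k) * INR (fact n) / (INR (fact k) * INR (fact (n - k)))).
  - field. auto.
  - apply (Rmult_eq_reg_r (INR (fact k) * INR (fact (n - k)))).
    + rewrite <- (Rmult_assoc (shift_coef n k)), H. field. auto.
    + apply Rmult_integral_contrapositive_currified; assumption.
Qed.

Lemma borel_ln : (fX * borel fln)%fps = (fC 1 - fexp (-1))%fps.
Proof.
  extensionality n. unfold fsub. destruct n as [|n].
  - rewrite fX_mulE0, fexp_0. simpl. ring.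
  - rewrite fX_mulE. unfold borel, fexp, fln. cbn [fC].
    rewrite fact_simpl, mult_INR. simpl pow. field.
    split; [apply INR_fact_neq_0 | apply not_0_INR; lia].
Qed.

(** * From the recurrence of the Landau increments to a differential equation *)

Definition landau_tail (n : nat) : R :=
  PI * landau n - (ln (16 * INR (n + 1)) + euler_gamma).

Definition landau_step (n : nat) : R := PI * odd_even_ratio (S n) ^ 2.

(** The constant term is 0 because [landau_tail] already has the logarithm and Euler's constant
    subtracted. *)
Definition landau_coef (alpha : nat -> R) : fps :=
  fun n => match n with O => 0 | S _ => alpha n end.

Lemma asym_landau_tail (alpha : nat -> R) :
  is_landau_expansion alpha -> asym landau_tail (landau_coef alpha).
Proof.
  intros H m. destruct (H m) as [C HC]. exists C. revert HC. apply filter_imp.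
  intros n Hn. unfold landau_tail.
  replace (sum_f_R0 (fun k => landau_coef alpha k * recipN n ^ k) m) with
    (sum_n_m (fun k => alpha k / INR (n + 1) ^ k) 1 m).
  - rewrite <- (Nat.add_1_r m). unfold recipN. rewrite <- pow_inv in Hn.
    rewrite (Rabs_right ((/ INR (n + 1)) ^ (m + 1))) in Hn.
    + eapply Rle_trans; [right; f_equal|exact Hn]. unfold Rminus.
      rewrite (Ropp_plus_distr (_ + _)), <- Rplus_assoc. reflexivity.
    + apply Rle_ge, pow_le, Rlt_le. exact (recipN_pos n).
  - clear. induction m as [|m IH].
    + rewrite sum_n_m_zero by lia. simpl. unfold zero; simpl; ring.
    + rewrite sum_n_Sm by lia. rewrite tech5, IH.
      unfold recipN. rewrite pow_inv. reflexivity.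
Qed.

Lemma landau_step_tail (n : nat) :
  landau_tail (S n) - landau_tail n + ln (1 + recipN n) = landau_step n.
Proof.
  unfold landau_tail, landau_step, landau. rewrite sum_Sn.
  match goal with |- context [plus ?a ?b] => change (plus a b) with (a + b) end.
  assert (HN : 0 < INR (n + 1)) by (apply lt_0_INR; lia).
  pose proof (recipN_pos n). rewrite Nat.add_succ_l.
  replace (INR (S (n + 1))) with (INR (n + 1) * (1 + recipN n)).
  - rewrite (ln_mult 16 (INR (n + 1) * _)), (ln_mult (INR (n + 1))), (ln_mult 16)
      by (lra || apply Rmult_lt_0_compat; lra). ring.
  - rewrite S_INR. unfold recipN. field. lra.
Qed.

Lemma landau_step_rec (n : nat) :
  (1 + recipN n) ^ 2 * landau_step (S n) = (1 + recipN n / 2) ^ 2 * landau_step n.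
Proof.
  unfold landau_step. cbn [odd_even_ratio].
  assert (HN : 0 < INR (n + 1)) by (apply lt_0_INR; lia).
  replace (INR (2 * S n + 1)) with (2 * INR (n + 1) + 1).
  2: { rewrite !plus_INR, mult_INR, (S_INR n). simpl. ring. }
  replace (INR (2 * S n + 2)) with (2 * INR (n + 1) + 2).
  2: { rewrite !plus_INR, mult_INR, (S_INR n). simpl. ring. }
  unfold recipN. field. repeat split; try lra.
  apply not_0_INR. lia.
Qed.

Definition step_coef (alpha : nat -> R) : fps :=
  (fshift (landau_coef alpha) + fC (-1) * landau_coef alpha + fln)%fps.

Lemma asym_landau_step (alpha : nat -> R) :
  is_landau_expansion alpha -> asym landau_step (step_coef alpha).
Proof.
  intros H. apply asym_landau_tail in H.
  eapply asym_ext; [exact landau_step_tail|].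
  eapply asym_ext; [|apply asym_add; [apply asym_add|exact asym_ln]].
  2: { apply asym_shift, H. } 2: { apply asym_scal, H. }
  intros n. simpl. ring.
Qed.

(** Both sides of [landau_step_rec] have expansions, and [asym_unique] turns the numerical identity
    into one between coefficients. *)
Lemma step_coef_rec (alpha : nat -> R) : is_landau_expansion alpha ->
  let b := step_coef alpha in
  (fshift b + fC 2 * (fX * fshift b) + fX * (fX * fshift b) =
   b + fX * b + fC (/ 4) * (fX * (fX * b)))%fps.
Proof.
  intros H b. pose proof (asym_landau_step alpha H) as Hb. fold b in Hb.
  pose proof (asym_shift _ _ Hb) as Hs. pose proof (asym_mulX _ _ Hs) as Hs1.
  pose proof (asym_mulX _ _ Hs1) as Hs2. pose proof (asym_mulX _ _ Hb) as Hb1.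
  pose proof (asym_mulX _ _ Hb1) as Hb2.
  eapply asym_unique.
  - exact (asym_add _ _ _ _ (asym_add _ _ _ _ Hs (asym_scal 2 _ _ Hs1)) Hs2).
  - eapply asym_ext; [|exact (asym_add _ _ _ _ (asym_add _ _ _ _ Hb Hb1)
                               (asym_scal (/ 4) _ _ Hb2))].
    intros n. simpl. pose proof (landau_step_rec n). simpl in *. nra.
Qed.

Lemma borel_step (alpha : nat -> R) :
  let h := fun n => alpha (S n) / INR (fact n) in
  (fX * borel (step_coef alpha) =
   (fC 1 - fexp (-1)) * (fC 1 - fX * h))%fps.
Proof.
  intros h.
  assert (E : borel (step_coef alpha) = (h * fexp (-1) - h + borel fln)%fps).
  { transitivity (borel (fshift (landau_coef alpha)) - borel (landau_coef alpha) + borel fln)%fps.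
    - extensionality n. unfold step_coef, borel, fadd, fsub. rewrite fC_mulE.
      field. apply INR_fact_neq_0.
    - rewrite borel_shift. reflexivity. }
  rewrite E.
  transitivity (fX * (h * fexp (-1) - h) + fX * borel fln)%fps; [ring|].
  rewrite borel_ln. ring.
Qed.

(** Multiplication by 1/N becomes integration in t, up to the dropped constant term. Applying t^2
    d^2/dt^2 = theta^2 - theta undoes two integrations and annihilates the integration constants. *)
Lemma borel_theta_shift2 (c d : fps) (p0 p1 p2 q1 q2 : R) :
  (fC p0 * c + fC p1 * (fX * c) + fC p2 * (fX * (fX * c)) =
   fC p0 * d + fC q1 * (fX * d) + fC q2 * (fX * (fX * d)))%fps ->
  (fC p0 * (theta (theta (borel c)) - theta (borel c)) +
     fC p1 * (fX * theta (borel c)) + fC p2 * (fX * (fX * borel c)) =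
   fC p0 * (theta (theta (borel d)) - theta (borel d)) +
     fC q1 * (fX * theta (borel d)) + fC q2 * (fX * (fX * borel d)))%fps.
Proof.
  intros H. extensionality n.
  pose proof (f_equal (fun h => h (S n)) H) as Hn. unfold fadd, fsub in *.
  rewrite !fC_mulE in *. unfold theta.
  (* In degrees 0 and 1, where integration constants would sit, both sides vanish. *)
  destruct n as [|[|n]].
  - rewrite !fX_mulE0. simpl. ring.
  - rewrite !fX_mulE, !fX_mulE0. simpl. ring.
  - rewrite !fX_mulE in *. unfold borel.
    replace (INR (fact (S (S n)))) with (INR (S (S n)) * INR (S n) * INR (fact n))
      by (rewrite !fact_simpl, !mult_INR; ring).
    replace (INR (fact (S n))) with (INR (S n) * INR (fact n))
      by (rewrite fact_simpl, mult_INR; ring).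
    assert (INR (S (S n)) = INR (S n) + 1) as E by (rewrite <- S_INR; reflexivity).
    pose proof (INR_fact_neq_0 n).
    assert (INR (S n) <> 0) by (apply not_0_INR; lia).
    assert (INR (S (S n)) <> 0) by (apply not_0_INR; lia).
    rewrite E in *. set (k := INR (S n)) in *.
    apply (Rmult_eq_reg_r (INR (fact n))); [|assumption].
    match goal with |- ?l * _ = ?r * _ =>
      replace (l * INR (fact n)) with
        (p0 * c (S (S (S n))) + p1 * c (S (S n)) + p2 * c (S n)) by (field; auto);
      replace (r * INR (fact n)) with
        (p0 * d (S (S (S n))) + q1 * d (S (S n)) + q2 * d (S n)) by (field; auto) end.
    exact Hn.
Qed.

Lemma borel_step_ode (alpha : nat -> R) : is_landau_expansion alpha ->
  let A := borel (step_coef alpha) in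
  let A' := (A * fexp (-1))%fps in
  (theta (theta A') - theta A' + fC 2 * (fX * theta A') + fX * (fX * A') =
   theta (theta A) - theta A + fX * theta A + fC (/ 4) * (fX * (fX * A)))%fps.
Proof.
  intros H A A'. pose proof (step_coef_rec alpha H) as Hr. cbv zeta in Hr.
  assert (HA : borel (fshift (step_coef alpha)) = A') by apply borel_shift.
  rewrite <- HA.
  pose proof (borel_theta_shift2 (fshift (step_coef alpha)) (step_coef alpha) 1 2 1 1 (/ 4)) as K.
  fold A in K.
  match type of K with ?P -> ?l = ?r =>
    assert (HP : P); [|specialize (K HP)] end.
  - match type of Hr with ?l = ?r => transitivity l; [ring|]; rewrite Hr; ring end.
  - match type of K with ?l = ?r => transitivity l; [ring|]; rewrite K; ring end.
Qed.

Lemma step_coef_1 (alpha : nat -> R) : borel (step_coef alpha) 0%nat = 1.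
Proof.
  unfold borel, step_coef, fadd. rewrite fC_mulE. simpl. field.
Qed.

(** In [step_coef] the two copies of [alpha 1] cancel and the logarithm contributes 1, so PI
    r_(n+1)^2 = 1/N + O(1/N^2). *)
Lemma odd_even_ratio_limit (alpha : nat -> R) : is_landau_expansion alpha ->
  is_lim_seq (fun n => INR n * odd_even_ratio n ^ 2) (/ PI).
Proof.
  intros H. apply is_lim_seq_incr_1.
  destruct (asym_landau_step alpha H 1%nat) as [C HC].
  assert (E0 : step_coef alpha 0%nat = 0).
  { unfold step_coef, fadd. rewrite fC_mulE. simpl. ring. }
  assert (E1 : step_coef alpha 1%nat = 1).
  { pose proof (step_coef_1 alpha) as E. unfold borel in E. simpl in E. lra. }
  pose proof PI_RGT_0 as Hpi.
  apply is_lim_seq_ext_loc with (u := fun n => / PI + / PI * (landau_step n / recipN n - 1)).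
  - exists 0%nat. intros n _. unfold landau_step, recipN. rewrite Nat.add_1_r.
    assert (INR (S n) <> 0) by (apply not_0_INR; lia). field. split; [assumption | lra].
  - replace (/ PI) with (/ PI + / PI * 0) at 1 by ring.
    apply is_lim_seq_plus'; [apply is_lim_seq_const|].
    apply (is_lim_seq_scal_l _ _ (Finite 0)).
    assert (HX : is_lim_seq recipN 0).
    { apply (is_lim_seq_spec recipN 0). intros e. cbn.
      generalize (recipN_small e (cond_pos e)). apply filter_imp. intros n Hn.
      rewrite Rminus_0_r, Rabs_right; [exact Hn|]. apply Rle_ge, Rlt_le, recipN_pos. }
    apply is_lim_seq_abs_0.
    apply (is_lim_seq_le_le_loc (fun _ => 0) _ (fun n => C * recipN n)).
    + revert HC. apply filter_imp. intros n Hn. split; [apply Rabs_pos|].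
      pose proof (recipN_pos n) as HXn. simpl in Hn. rewrite E0, E1 in Hn.
      apply (Rmult_le_reg_r (recipN n)); [exact HXn|].
      rewrite <- (Rabs_right (recipN n)) at 2 by lra. rewrite <- Rabs_mult.
      replace ((landau_step n / recipN n - 1) * recipN n) with
        (landau_step n - (0 * 1 + 1 * (recipN n * 1))) by (field; lra).
      lra.
    + apply is_lim_seq_const.
    + replace (Finite 0) with (Finite (C * 0)) by (f_equal; ring).
      apply (is_lim_seq_scal_l _ _ (Finite 0)), HX.
Qed.

(** * Hyperbolic functions of t / 4 and the Legendre equation *)

Definition tau : fps := (fC (/ 4) * fX)%fps.
Definition eu : fps := fexp (/ 4).
Definition ev : fps := fexp (- / 4).

(* [sinh (t / 4) / (t / 4)] and [cosh (t / 4)] *)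
Definition sinhc4 : fps := fun n => 2 * (eu (S n) - ev (S n)).
Definition cosh4 : fps := fun n => (eu n + ev n) / 2.

(** Small integers are written as repeated sums: [ring] on [fps] treats [fC 2] or [fC 4] as
    atoms. *)
Lemma fX_tau : fX = (tau + tau + tau + tau)%fps.
Proof.
  extensionality n. unfold tau, fadd. rewrite fC_mulE. field.
Qed.

Lemma theta_tau : theta tau = tau.
Proof. unfold tau. rewrite theta_mul, theta_C, theta_X. ring. Qed.

Lemma theta_eu : theta eu = (tau * eu)%fps.
Proof. unfold eu, tau. apply theta_exp. Qed.

Lemma theta_ev : theta ev = (- tau * ev)%fps.
Proof.
  unfold ev, tau. rewrite theta_exp.
  replace (fC (- / 4)) with (- fC (/ 4))%fps; [ring|].
  extensionality n. unfold fopp. destruct n; simpl; ring.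
Qed.

Lemma eu_ev : (eu * ev)%fps = fC 1.
Proof.
  rewrite (theta_eq0 (eu * ev)%fps).
  - f_equal. rewrite fmul_0. unfold eu, ev. rewrite !fexp_0. ring.
  - rewrite theta_mul, theta_eu, theta_ev. ring.
Qed.

Lemma fexp_m1_ev : fexp (-1) = (ev * ev * ev * ev)%fps.
Proof.
  assert (K : (fexp (-1) * (eu * eu * eu * eu))%fps = fC 1).
  { rewrite (theta_eq0 (fexp (-1) * (eu * eu * eu * eu))%fps).
    - f_equal. rewrite !fmul_0. unfold eu. rewrite !fexp_0. ring.
    - rewrite !theta_mul, theta_exp, theta_eu, fX_tau.
      replace (fC (-1)) with (- fC 1)%fps; [ring|].
      extensionality n. unfold fopp. destruct n; simpl; ring. }
  transitivity (fexp (-1) * (eu * ev) * (eu * ev) * (eu * ev) * (eu * ev))%fps.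
  - rewrite eu_ev. ring.
  - transitivity (fexp (-1) * (eu * eu * eu * eu) * (ev * ev * ev * ev))%fps; [ring|].
    rewrite K. ring.
Qed.

Lemma eu_minus_ev : (eu - ev)%fps = (tau * sinhc4 + tau * sinhc4)%fps.
Proof.
  extensionality n. unfold tau, fadd. rewrite <- fmulA, fC_mulE. unfold fsub.
  destruct n as [|n].
  - rewrite fX_mulE0. unfold eu, ev. rewrite !fexp_0. ring.
  - rewrite fX_mulE. unfold sinhc4. field.
Qed.

Lemma eu_plus_ev : (eu + ev)%fps = (cosh4 + cosh4)%fps.
Proof. extensionality n. unfold cosh4, fadd. field. Qed.

Lemma eu_cosh_sinh : eu = (cosh4 + tau * sinhc4)%fps.
Proof.
  extensionality n.
  pose proof (f_equal (fun h => h n) eu_minus_ev) as H1.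
  pose proof (f_equal (fun h => h n) eu_plus_ev) as H2.
  unfold fadd, fsub in *. lra.
Qed.

Lemma eu2_minus_ev2 : (eu * eu - ev * ev)%fps = (fX * (sinhc4 * cosh4))%fps.
Proof.
  transitivity ((eu - ev) * (eu + ev))%fps; [ring|].
  rewrite eu_minus_ev, eu_plus_ev, fX_tau. ring.
Qed.

Lemma fC2 : fC 2 = (fC 1 + fC 1)%fps.
Proof. rewrite fC_add. reflexivity. Qed.

(** The factor e^(t/4) makes the two sides mirror images under t -> -t: they become e^(-5t/4) and
    e^(-t/4) times theta^2 E - theta E -/+ 2 tau theta E + tau^2 E. Their balance is a Legendre
    equation in self-adjoint form, with weight sinh (t/2) / (t/2). *)
Lemma kernel_ode (A : fps) :
  let A' := (A * fexp (-1))%fps in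
  (theta (theta A') - theta A' + fC 2 * (fX * theta A') + fX * (fX * A') =
   theta (theta A) - theta A + fX * theta A + fC (/ 4) * (fX * (fX * A)))%fps ->
  let E := (eu * A)%fps in
  theta (sinhc4 * cosh4 * theta E)%fps = (- (tau * tau * (sinhc4 * cosh4 * E)))%fps.
Proof.
  intros A' H E. set (Sh := (sinhc4 * cosh4)%fps).
  assert (HA : A = (ev * E)%fps).
  { unfold E. transitivity (eu * ev * A)%fps; [rewrite eu_ev|]; ring. }
  assert (H4 : (fC (/ 4) * (fX * (fX * A)))%fps = (tau * (fX * A))%fps)
    by (unfold tau; ring).
  rewrite H4, fC2 in H. unfold A' in H. rewrite fexp_m1_ev, HA in H.
  clearbody E. clear HA H4 A' A.
  repeat (rewrite ?theta_mul, ?theta_add, ?theta_opp, ?theta_ev, ?theta_tau in H).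
  assert (HS : (fX * Sh)%fps = (eu * eu - ev * ev)%fps) by (symmetry; apply eu2_minus_ev2).
  assert (HS' : (fX * (Sh + theta Sh))%fps =
    ((tau + tau) * (eu * eu + ev * ev))%fps).
  { transitivity (theta (fX * Sh))%fps.
    - rewrite theta_mul, theta_X. ring.
    - rewrite HS, theta_sub, !theta_mul, theta_eu, theta_ev. ring. }
  rewrite theta_mul. apply fX_cancel.
  assert (G : (fX * (Sh * (theta (theta E) - theta E + tau * tau * E) +
                      (Sh + theta Sh) * theta E))%fps = fC 0).
  { transitivity ((fX * Sh) * (theta (theta E) - theta E + tau * tau * E) +
                  (fX * (Sh + theta Sh)) * theta E)%fps; [ring|].
    rewrite HS, HS'. rewrite fX_tau in H.
    (* Multiplying by e^(3t/4) centres the exponentials at e^(t/2) and e^(-t/2), whose difference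
       and sum are [HS] and [HS']. *)
    match type of H with ?l = ?r =>
      transitivity (eu * eu * eu * (r - l))%fps; [|rewrite H; ring] end.
    pose proof eu_ev as Huv. ring [Huv]. }
  transitivity (fX * (Sh * (theta (theta E) - theta E + tau * tau * E) +
                      (Sh + theta Sh) * theta E) + fX * (- (tau * tau * (Sh * E))))%fps;
    [ring|].
  rewrite G. ring.
Qed.

(** Multiplying 1 - e^(-t) by e^(t/2) gives 2 sinh (t/2), which is t [sinhc4] [cosh4]; the remaining
    e^(t/4) on the right is split into its even and odd parts. *)
Lemma kernel_product (A H : fps) :
  (fX * A = (fC 1 - fexp (-1)) * H)%fps ->
  ((sinhc4 * cosh4) * H = (cosh4 + tau * sinhc4) * (eu * A))%fps.
Proof.
  intros K. rewrite <- eu_cosh_sinh. apply fX_cancel.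
  transitivity (eu * eu * (fX * A))%fps; [|ring].
  rewrite K, fexp_m1_ev.
  transitivity ((fX * (sinhc4 * cosh4)) * H)%fps; [ring|].
  rewrite <- eu2_minus_ev2. pose proof eu_ev as Huv. ring [Huv].
Qed.

(** * Even and odd parts, in the variable [s] with [t^2 = - 4 PI^2 s] *)

Definition lambda : R := - (4 * PI ^ 2).
Definition epart (f : fps) : fps := fun k => f (2 * k)%nat * lambda ^ k.
(** The odd part divided by t, in the variable s. *)
Definition opart (f : fps) : fps := fun k => f (S (2 * k)) * lambda ^ k.
Definition is_even (f : fps) : Prop := forall k, f (S (2 * k)) = 0.

Lemma sum_f_R0_even (a : nat -> R) (k : nat) :
  (forall i, (i < k)%nat -> a (S (2 * i)) = 0) ->
  sum_f_R0 a (2 * k) = sum_f_R0 (fun i => a (2 * i)%nat) k.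
Proof.
  induction k as [|k IH]; intros H; [reflexivity|].
  replace (2 * S k)%nat with (S (S (2 * k))) by lia.
  rewrite !tech5, IH, H by (intros; try apply H; lia).
  replace (2 * S k)%nat with (S (S (2 * k))) by lia. ring.
Qed.

Lemma epart_mul (g f : fps) : is_even g -> epart (g * f)%fps = (epart g * epart f)%fps.
Proof.
  intros Hg. extensionality k. unfold epart, fmul. rewrite Rmult_comm.
  rewrite sum_f_R0_even by (intros i _; rewrite Hg; ring).
  rewrite <- sum_f_R0_scal. apply sum_eq. intros i Hi.
  replace (2 * k - 2 * i)%nat with (2 * (k - i))%nat by lia.
  replace (lambda ^ k) with (lambda ^ i * lambda ^ (k - i))
    by (rewrite <- pow_add; f_equal; lia).
  ring.
Qed.

Lemma opart_mul (g f : fps) : is_even g -> opart (g * f)%fps = (epart g * opart f)%fps.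
Proof.
  intros Hg. extensionality k. unfold epart, opart, fmul. rewrite Rmult_comm, tech5, Hg.
  rewrite sum_f_R0_even by (intros i _; rewrite Hg; ring).
  rewrite Rmult_0_l, Rplus_0_r, <- sum_f_R0_scal. apply sum_eq. intros i Hi.
  replace (S (2 * k) - 2 * i)%nat with (S (2 * (k - i)))%nat by lia.
  replace (lambda ^ k) with (lambda ^ i * lambda ^ (k - i))
    by (rewrite <- pow_add; f_equal; lia).
  ring.
Qed.

Lemma is_even_mul (f g : fps) : is_even f -> is_even g -> is_even (f * g)%fps.
Proof.
  intros Hf Hg k. pose proof (opart_mul f g Hf) as H.
  pose proof (f_equal (fun h => h k) H) as Hk.
  assert (Z : opart g = fC 0).
  { extensionality n. unfold opart. rewrite Hg. destruct n; simpl; ring. }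
  rewrite Z in Hk. replace (epart f * fC 0)%fps with (fC 0) in Hk by ring.
  unfold opart in Hk. replace (fC 0 k) with 0 in Hk by (destruct k; reflexivity).
  apply Rmult_integral in Hk. destruct Hk as [Hk|Hk]; [exact Hk|].
  exfalso. revert Hk. apply pow_nonzero. unfold lambda.
  pose proof PI_RGT_0. nra.
Qed.

Lemma epart_fX (g : fps) : is_even g -> epart (fX * g)%fps = fC 0.
Proof.
  intros Hg. extensionality k. unfold epart. destruct k as [|k].
  - rewrite Nat.mul_0_r, fX_mulE0. simpl. ring.
  - replace (2 * S k)%nat with (S (S (2 * k))) by lia.
    rewrite fX_mulE, Hg. simpl. ring.
Qed.

Lemma opart_fX (g : fps) : opart (fX * g)%fps = epart g.
Proof. extensionality k. unfold opart. rewrite fX_mulE. reflexivity. Qed.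

Lemma epart_fXX (g : fps) : epart (fX * (fX * g))%fps = (fC lambda * (fX * epart g))%fps.
Proof.
  extensionality k. rewrite fC_mulE. unfold epart at 1. destruct k as [|k].
  - rewrite Nat.mul_0_r, !fX_mulE0. ring.
  - replace (2 * S k)%nat with (S (S (2 * k))) by lia.
    rewrite !fX_mulE. unfold epart. simpl. ring.
Qed.

Lemma opart_fXX (g : fps) : opart (fX * (fX * g))%fps = (fC lambda * (fX * opart g))%fps.
Proof.
  extensionality k. rewrite fC_mulE. unfold opart at 1. destruct k as [|k].
  - rewrite Nat.mul_0_r, fX_mulE, !fX_mulE0. ring.
  - replace (2 * S k)%nat with (S (S (2 * k))) by lia.
    rewrite !fX_mulE. unfold opart. simpl. ring.
Qed.

Lemma epart_theta (f : fps) : epart (theta f) = (fC 2 * theta (epart f))%fps.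
Proof.
  extensionality k. rewrite fC_mulE. unfold theta, epart. rewrite mult_INR. simpl. ring.
Qed.

Lemma opart_theta (f : fps) : opart (theta f) = (fC 2 * theta (opart f) + opart f)%fps.
Proof.
  extensionality k. unfold fadd. rewrite fC_mulE. unfold theta, opart.
  rewrite S_INR, mult_INR. simpl. ring.
Qed.

Lemma epart_add (f g : fps) : epart (f + g)%fps = (epart f + epart g)%fps.
Proof. extensionality k. unfold epart, fadd. ring. Qed.

Lemma opart_add (f g : fps) : opart (f + g)%fps = (opart f + opart g)%fps.
Proof. extensionality k. unfold opart, fadd. ring. Qed.

Lemma epart_scal (x : R) (f : fps) : epart (fC x * f)%fps = (fC x * epart f)%fps.
Proof. extensionality k. rewrite fC_mulE. unfold epart. rewrite fC_mulE. ring. Qed.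

Lemma opart_scal (x : R) (f : fps) : opart (fC x * f)%fps = (fC x * opart f)%fps.
Proof. extensionality k. rewrite fC_mulE. unfold opart. rewrite fC_mulE. ring. Qed.

(* [sin (PI x / 2) / (PI x / 2)] and [cos (PI x / 2)] in the variable [s = x^2] *)
Definition sincH : fps := fun k => (- (PI / 2) ^ 2) ^ k / INR (fact (S (2 * k))).
Definition cosH : fps := fun k => (- (PI / 2) ^ 2) ^ k / INR (fact (2 * k)).

Lemma epart_sinhc4 : epart sinhc4 = sincH.
Proof.
  extensionality k. unfold epart, sinhc4, eu, ev, fexp, sincH, lambda.
  replace (- (PI / 2) ^ 2) with ((/ 4) ^ 2 * - (4 * PI ^ 2)) by field.
  rewrite Rpow_mult_distr, <- pow_mult.
  assert (E : (- / 4) ^ S (2 * k) = - (/ 4) ^ S (2 * k)).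
  { replace (- / 4) with (-1 * / 4) by ring. rewrite Rpow_mult_distr, pow_1_odd. ring. }
  rewrite E. simpl pow. field. apply INR_fact_neq_0.
Qed.

Lemma epart_cosh4 : epart cosh4 = cosH.
Proof.
  extensionality k. unfold epart, cosh4, eu, ev, fexp, cosH, lambda.
  replace (- (PI / 2) ^ 2) with ((/ 4) ^ 2 * - (4 * PI ^ 2)) by field.
  rewrite Rpow_mult_distr, <- pow_mult.
  assert (E : (- / 4) ^ (2 * k) = (/ 4) ^ (2 * k)).
  { replace (- / 4) with (-1 * / 4) by ring. rewrite Rpow_mult_distr, pow_1_even. ring. }
  rewrite E. field. apply INR_fact_neq_0.
Qed.

Lemma is_even_sinhc4 : is_even sinhc4.
Proof.
  intros k. unfold sinhc4, eu, ev, fexp.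
  replace (S (S (2 * k))) with (2 * S k)%nat by lia.
  replace (- / 4) with (-1 * / 4) by ring. rewrite Rpow_mult_distr, pow_1_even.
  rewrite Rmult_1_l, Rminus_diag. apply Rmult_0_r.
Qed.

Lemma is_even_cosh4 : is_even cosh4.
Proof.
  intros k. unfold cosh4, eu, ev, fexp.
  replace (- / 4) with (-1 * / 4) by ring. rewrite Rpow_mult_distr, pow_1_odd.
  field. apply INR_fact_neq_0.
Qed.

Lemma sincH_0 : sincH 0%nat = 1.
Proof. unfold sincH. simpl. field. Qed.

Lemma cosH_0 : cosH 0%nat = 1.
Proof. unfold cosH. simpl. field. Qed.

Lemma lambda_neq0 : lambda <> 0.
Proof. unfold lambda. pose proof PI_RGT_0. nra. Qed.

Lemma tau_tau (f : fps) : (tau * tau * f)%fps = (fC (/ 16) * (fX * (fX * f)))%fps.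
Proof.
  replace (fC (/ 16)) with (fC (/ 4) * fC (/ 4))%fps.
  - unfold tau. ring.
  - rewrite fC_mul. f_equal. field.
Qed.

(** On odd parts [theta] acts as D, with eigenvalue 2 k + 1. The leading factor (2 k + 1)^2 of the
    recurrence never vanishes, and no free initial coefficient is left. *)
Lemma kernel_ode_odd (S o : fps) (k0 : R) : S 0%nat = 1 ->
  let D := fun f => (fC 2 * theta f + f)%fps in
  D (S * D o)%fps = (fC k0 * (fX * (S * o)))%fps -> forall k, o k = 0.
Proof.
  intros HS D H k. apply (well_founded_induction Wf_nat.lt_wf) with (a := k).
  clear k. intros k IH. pose proof (f_equal (fun h => h k) H) as Hk.
  assert (HD : forall f i, D f i = (2 * INR i + 1) * f i).
  { intros f i. unfold D, fadd. rewrite fC_mulE. unfold theta. ring. }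
  simpl in Hk. rewrite HD, fC_mulE in Hk.
  replace ((fX * (S * o))%fps k) with 0 in Hk.
  - rewrite Rmult_0_r in Hk. unfold fmul in Hk.
    rewrite sum_f_R0_head in Hk.
    + rewrite HS, Nat.sub_0_r, HD in Hk. pose proof (pos_INR k).
      apply Rmult_integral in Hk. destruct Hk as [Hk|Hk]; [lra|].
      rewrite Rmult_1_l in Hk. apply Rmult_integral in Hk. destruct Hk; lra.
    + intros i Hi. rewrite HD, IH by lia. ring.
  - destruct k as [|k]; [rewrite fX_mulE0; reflexivity|]. rewrite fX_mulE.
    unfold fmul. rewrite sum_f_R0_zero; [reflexivity|].
    intros i Hi. rewrite IH by lia. ring.
Qed.

(* [y] is the Legendre function [P_{-1/2} (cos (PI x))] in the variable [s = x^2]. *)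
Lemma landau_reduction (alpha : nat -> R) : is_landau_expansion alpha ->
  exists y : fps, y 0%nat = 1 /\
    (fC 4 * theta (sincH * cosH * theta y) =
     fC (PI ^ 2 / 4) * (fX * (sincH * cosH * y)))%fps /\
    (forall k, alpha (2 * S k)%nat / INR (fact (2 * k + 1)) * lambda ^ S k =
               - (y * finv sincH)%fps (S k)) /\
    (forall k, alpha (2 * k + 1)%nat / INR (fact (2 * k)) * lambda ^ k =
               - (/ 4 * (y * finv cosH)%fps k)).
Proof.
  intros Hal. pose proof (borel_step_ode alpha Hal) as Hode.
  pose proof (borel_step alpha) as Hst. cbv zeta in Hode, Hst.
  apply kernel_ode in Hode. apply kernel_product in Hst.
  set (h := fun n => alpha (S n) / INR (fact n)) in *.
  set (E := (eu * borel (step_coef alpha))%fps) in *.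
  set (H := (fC 1 - fX * h)%fps) in *.
  assert (HE0 : E 0%nat = 1).
  { unfold E. rewrite fmul_0, step_coef_1. unfold eu. rewrite fexp_0. ring. }
  rewrite tau_tau in Hode.
  replace (- (fC (/ 16) * (fX * (fX * (sinhc4 * cosh4 * E)))))%fps with
    (fC (- / 16) * (fX * (fX * (sinhc4 * cosh4 * E))))%fps in Hode.
  2: { extensionality n. unfold fopp. rewrite !fC_mulE. ring. }
  pose proof is_even_sinhc4 as Hs. pose proof is_even_cosh4 as Hc.
  pose proof (is_even_mul _ _ Hs Hc) as Hsc.
  assert (Hep : epart (sinhc4 * cosh4)%fps = (sincH * cosH)%fps).
  { rewrite epart_mul by exact Hs. rewrite epart_sinhc4, epart_cosh4. reflexivity. }
  assert (Hlam : - / 16 * lambda = PI ^ 2 / 4) by (unfold lambda; field).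
  assert (Hodd : forall k, opart E k = 0).
  { apply (kernel_ode_odd (sincH * cosH)%fps (opart E) (PI ^ 2 / 4)).
    - rewrite fmul_0, sincH_0, cosH_0. ring.
    - pose proof (f_equal opart Hode) as Ho.
      rewrite opart_theta, opart_scal, opart_fXX, !opart_mul, opart_theta, Hep in Ho
        by assumption.
      rewrite Ho, fmulA, fC_mul, Hlam. reflexivity. }
  assert (HEev : is_even E).
  { intros k. specialize (Hodd k). unfold opart in Hodd. apply Rmult_integral in Hodd.
    destruct Hodd as [K|K]; [exact K|]. exfalso. revert K. apply pow_nonzero, lambda_neq0. }
  assert (HoE : opart E = fC 0).
  { extensionality k. rewrite Hodd. destruct k; reflexivity. }
  exists (epart E). repeat split.
  - unfold epart. rewrite Nat.mul_0_r, HE0. simpl. ring.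
  - pose proof (f_equal epart Hode) as He.
    rewrite epart_theta, epart_scal, epart_fXX, !(epart_mul (sinhc4 * cosh4)%fps),
      epart_theta, Hep in He
      by assumption.
    rewrite (fmulA (fC (- / 16))), fC_mul, Hlam in He. rewrite <- He.
    replace (fC 4) with (fC 2 * fC 2)%fps by (rewrite fC_mul; f_equal; ring).
    rewrite !theta_mul, theta_C. ring.
  - intros k. pose proof (f_equal epart Hst) as He.
    replace ((cosh4 + tau * sinhc4) * E)%fps with
      (cosh4 * E + fC (/ 4) * (fX * (sinhc4 * E)))%fps in He by (unfold tau; ring).
    rewrite epart_mul, Hep, epart_add, epart_scal, epart_fX, epart_mul, epart_cosh4 in He
      by (try apply is_even_mul; assumption).
    (* E being even, only [cosh4 * E] is even on the right; dividing by sinh and cosh leaves 1 /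
       sinh. *)
    assert (K : epart H = (epart E * finv sincH)%fps).
    { transitivity ((sincH * cosH * epart H) * finv sincH * finv cosH)%fps.
      - transitivity ((sincH * finv sincH) * (cosH * finv cosH) * epart H)%fps; [|ring].
        rewrite !finv_mul by (apply sincH_0 || apply cosH_0). ring.
      - rewrite He. transitivity ((cosH * finv cosH) * (epart E * finv sincH))%fps; [ring|].
        rewrite finv_mul by apply cosH_0. ring. }
    rewrite <- K. unfold epart, H, fsub.
    replace (2 * S k)%nat with (S (2 * k + 1)) by lia. rewrite fX_mulE. unfold h.
    cbn [fC]. field. apply INR_fact_neq_0.
  - intros k. pose proof (f_equal opart Hst) as He.
    replace ((cosh4 + tau * sinhc4) * E)%fps with
      (cosh4 * E + fC (/ 4) * (fX * (sinhc4 * E)))%fps in He by (unfold tau; ring).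
    rewrite opart_mul, Hep, opart_add, opart_scal, opart_fX, opart_mul, HoE,
      epart_mul, epart_sinhc4 in He by assumption.
    (* Only the term t [sinhc4] E / 4 is odd; the same division leaves 1 / cosh. *)
    assert (K : opart H = (fC (/ 4) * (epart E * finv cosH))%fps).
    { transitivity ((sincH * cosH * opart H) * finv sincH * finv cosH)%fps.
      - transitivity ((sincH * finv sincH) * (cosH * finv cosH) * opart H)%fps; [|ring].
        rewrite !finv_mul by (apply sincH_0 || apply cosH_0). ring.
      - rewrite He.
        transitivity (fC (/ 4) * ((sincH * finv sincH) * (epart E * finv cosH)))%fps; [ring|].
        rewrite finv_mul by apply sincH_0. ring. }
    pose proof (f_equal (fun g => g k) K) as Kk. simpl in Kk. rewrite fC_mulE in Kk.
    rewrite <- Kk. unfold opart, H, fsub. rewrite fX_mulE. unfold h.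
    replace (2 * k + 1)%nat with (S (2 * k)) by lia.
    cbn [fC]. field. apply INR_fact_neq_0.
Qed.

(** * Growth of coefficient sequences *)

Definition geo_decay (f : fps) : Prop :=
  exists K r, 0 <= K /\ 0 < r < 1 /\ forall n, Rabs (f n) <= K * r ^ n.

(** The weight n + 1 stays nonzero at n = 0, and p = 0 means boundedness. *)
Definition poly_decay (p : nat) (f : fps) : Prop :=
  exists K, forall n, Rabs (f n) <= K / INR (S n) ^ p.

Lemma INR_S_pos (n : nat) : 0 < INR (S n).
Proof. apply lt_0_INR. lia. Qed.

(** Bernoulli's inequality for 1/r = 1 + d. *)
Lemma weight_geometric (r : R) : 0 < r < 1 ->
  exists C, 0 <= C /\ forall n, INR (S n) * r ^ n <= C.
Proof.
  intros Hr. set (d := / r - 1).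
  assert (Hd : 0 < d).
  { unfold d. assert (1 < / r) by (rewrite <- Rinv_1; apply Rinv_lt_contravar; lra). lra. }
  assert (Hid : 0 < / d) by (apply Rinv_0_lt_compat; exact Hd).
  exists (1 + / d). split; [lra|]. intros n.
  pose proof (poly n d Hd) as Hp. replace (1 + d) with (/ r) in Hp by (unfold d; ring).
  rewrite pow_inv in Hp. assert (Hrn : 0 < r ^ n) by (apply pow_lt; lra).
  apply (Rmult_le_compat_r (r ^ n)) in Hp; [|lra]. rewrite Rinv_l in Hp by lra.
  rewrite S_INR. pose proof (pos_INR n).
  assert (/ d * ((1 + INR n * d) * r ^ n) <= / d * 1) by (apply Rmult_le_compat_l; lra).
  replace (/ d * ((1 + INR n * d) * r ^ n)) with ((/ d + INR n) * r ^ n) in H0 by (field; lra).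
  assert (r ^ n <= 1) by (rewrite <- (pow1 n); apply pow_incr; lra). nra.
Qed.

(** Write r as the square of [sqrt r]: one factor absorbs the weight, the other remains as the new
    ratio. *)
Lemma geo_decay_weight (f : fps) : geo_decay f -> geo_decay (fun n => INR (S n) * f n).
Proof.
  intros (K & r & HK & Hr & H).
  assert (Hs : 0 < sqrt r < 1).
  { split; [apply sqrt_lt_R0; lra|]. rewrite <- sqrt_1. apply sqrt_lt_1; lra. }
  destruct (weight_geometric (sqrt r) Hs) as (C & HC & HCn).
  exists (C * K), (sqrt r). split; [nra|]. split; [exact Hs|]. intros n.
  rewrite Rabs_mult, Rabs_right by (apply Rle_ge, Rlt_le, INR_S_pos).
  specialize (H n). specialize (HCn n).
  replace (r ^ n) with (sqrt r ^ n * sqrt r ^ n) in H.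
  2: { rewrite <- Rpow_mult_distr, sqrt_sqrt by lra. reflexivity. }
  assert (0 < sqrt r ^ n) by (apply pow_lt; lra). pose proof (INR_S_pos n).
  apply Rle_trans with (INR (S n) * (K * (sqrt r ^ n * sqrt r ^ n))); [nra|].
  replace (INR (S n) * (K * (sqrt r ^ n * sqrt r ^ n))) with
    (K * sqrt r ^ n * (INR (S n) * sqrt r ^ n)) by ring.
  replace (C * K * sqrt r ^ n) with (K * sqrt r ^ n * C) by ring.
  apply Rmult_le_compat_l; [nra | exact HCn].
Qed.

Lemma geo_decay_le (f g : fps) :
  (forall n, Rabs (f n) <= Rabs (g n)) -> geo_decay g -> geo_decay f.
Proof.
  intros Hfg (K & r & HK & Hr & H). exists K, r. repeat split; try assumption; try lra.
  intros n. eapply Rle_trans; [apply Hfg | apply H].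
Qed.

Lemma geo_decay_mul (f g : fps) : geo_decay f -> geo_decay g -> geo_decay (f * g)%fps.
Proof.
  intros (K & r & HK & Hr & H) (K' & r' & HK' & Hr' & H').
  set (m := Rmax r r').
  assert (Hm : 0 < m < 1).
  { unfold m. split; [apply Rlt_le_trans with r; [lra | apply Rmax_l]|].
    apply Rmax_lub_lt; lra. }
  apply (geo_decay_le _ (fun n => INR (S n) * (K * K' * m ^ n))).
  - intros n. rewrite (Rabs_right (INR (S n) * _)).
    2: { apply Rle_ge. pose proof (INR_S_pos n). assert (0 < m ^ n) by (apply pow_lt; lra).
         assert (0 <= K * K') by nra. assert (0 <= K * K' * m ^ n) by nra. nra. }
    unfold fmul. eapply Rle_trans; [apply Rsum_abs|].
    eapply Rle_trans; [apply (sum_Rle _ (fun _ => K * K' * m ^ n))|].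
    + intros i Hi. rewrite Rabs_mult.
      replace (K * K' * m ^ n) with ((K * m ^ i) * (K' * m ^ (n - i))).
      2: { replace (m ^ n) with (m ^ i * m ^ (n - i)) by (rewrite <- pow_add; f_equal; lia).
           ring. }
      apply Rmult_le_compat; try apply Rabs_pos.
      * eapply Rle_trans; [apply H|]. apply Rmult_le_compat_l; [exact HK|].
        apply pow_incr. split; [lra | apply Rmax_l].
      * eapply Rle_trans; [apply H'|]. apply Rmult_le_compat_l; [exact HK'|].
        apply pow_incr. split; [lra | apply Rmax_r].
    + rewrite sum_cte. lra.
  - apply geo_decay_weight. exists (K * K'), m. split; [nra|]. split; [exact Hm|].
    intros n. rewrite Rabs_right; [lra|]. apply Rle_ge.
    apply Rmult_le_pos; [nra | apply pow_le; lra].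
Qed.

Lemma geo_decay_theta (f : fps) : geo_decay f -> geo_decay (theta f).
Proof.
  intros H. apply geo_decay_weight in H. revert H. apply geo_decay_le. intros n.
  unfold theta. rewrite !Rabs_mult. apply Rmult_le_compat_r; [apply Rabs_pos|].
  pose proof (pos_INR n). rewrite !Rabs_right; rewrite ?S_INR; lra.
Qed.

Lemma geo_decay_scal (x : R) (f : fps) : geo_decay f -> geo_decay (fC x * f)%fps.
Proof.
  intros (K & r & HK & Hr & H). exists (Rabs x * K), r.
  pose proof (Rabs_pos x). split; [nra|]. split; [exact Hr|]. intros n.
  rewrite fC_mulE, Rabs_mult, Rmult_assoc. apply Rmult_le_compat_l; [assumption | apply H].
Qed.

Lemma geo_decay_sum (f : fps) : geo_decay f ->
  exists B, 0 <= B /\ forall n, sum_f_R0 (fun i => Rabs (f i)) n <= B.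
Proof.
  intros (K & r & HK & Hr & H). exists (K / (1 - r)). split.
  { apply Rdiv_le_0_compat; lra. }
  intros n. eapply Rle_trans; [apply (sum_Rle _ (fun i => K * r ^ i)); intros; apply H|].
  rewrite sum_f_R0_scal, tech3 by lra. unfold Rdiv. apply Rmult_le_compat_l; [exact HK|].
  assert (0 < r ^ S n) by (apply pow_lt; lra).
  assert (0 < / (1 - r)) by (apply Rinv_0_lt_compat; lra). nra.
Qed.

Lemma poly_decay_nonneg (p : nat) (f : fps) : poly_decay p f ->
  exists K, 0 <= K /\ forall n, Rabs (f n) <= K / INR (S n) ^ p.
Proof.
  intros [K H]. exists K. split; [|exact H]. specialize (H 0%nat). simpl INR in H.
  rewrite pow1 in H. pose proof (Rabs_pos (f 0%nat)). lra.
Qed.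

Lemma poly_decay_add (p : nat) (f g : fps) :
  poly_decay p f -> poly_decay p g -> poly_decay p (f + g)%fps.
Proof.
  intros [K H] [K' H']. exists (K + K'). intros n. unfold fadd.
  eapply Rle_trans; [apply Rabs_triang|]. specialize (H n). specialize (H' n).
  unfold Rdiv in *. lra.
Qed.

Lemma poly_decay_scal (p : nat) (x : R) (f : fps) :
  poly_decay p f -> poly_decay p (fC x * f)%fps.
Proof.
  intros [K H]. exists (Rabs x * K). intros n. rewrite fC_mulE, Rabs_mult.
  unfold Rdiv. rewrite Rmult_assoc. apply Rmult_le_compat_l; [apply Rabs_pos | apply H].
Qed.

Lemma poly_decay_weaken (p q : nat) (f : fps) :
  (q <= p)%nat -> poly_decay p f -> poly_decay q f.
Proof.
  intros Hpq H. apply poly_decay_nonneg in H. destruct H as (K & HK & H). exists K.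
  intros n. eapply Rle_trans; [apply H|]. unfold Rdiv. apply Rmult_le_compat_l; [exact HK|].
  apply Rinv_le_contravar; [apply pow_lt, INR_S_pos|]. apply Rle_pow; [|exact Hpq].
  rewrite S_INR. pose proof (pos_INR n). lra.
Qed.

Lemma poly_decay_theta (f : fps) : poly_decay 1 f -> poly_decay 0 (theta f).
Proof.
  intros [K HK]. exists K. intros n. unfold theta.
  specialize (HK n). rewrite pow_1 in HK. rewrite pow_O. unfold Rdiv.
  rewrite Rinv_1, Rmult_1_r.
  rewrite Rabs_mult, Rabs_right by (apply Rle_ge, pos_INR).
  pose proof (INR_S_pos n). pose proof (Rabs_pos (f n)).
  apply (Rmult_le_compat_l (INR (S n))) in HK; [|lra].
  replace (INR (S n) * (K / INR (S n))) with K in HK by (field; lra).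
  rewrite S_INR in *. nra.
Qed.

Lemma geo_poly_decay (p : nat) (f : fps) : geo_decay f -> poly_decay p f.
Proof.
  revert f. induction p as [|p IH]; intros f H.
  - destruct H as (K & r & HK & Hr & H). exists K. intros n. simpl.
    assert (r ^ n <= 1) by (rewrite <- (pow1 n); apply pow_incr; lra).
    specialize (H n). unfold Rdiv. rewrite Rinv_1. nra.
  - apply geo_decay_weight, IH in H. destruct H as [K H]. exists K. intros n.
    specialize (H n). pose proof (INR_S_pos n).
    rewrite Rabs_mult, Rabs_right in H by lra.
    apply (Rmult_le_reg_l (INR (S n))); [assumption|].
    eapply Rle_trans; [exact H|]. right. set (x := INR (S n)) in *.
    change (x ^ S p) with (x * x ^ p). field. split; [apply pow_nonzero|]; lra.
Qed.

(* [n + 1 <= (i + 1) (n - i + 1)] moves the polynomial weight to the geometric factor. *)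
Lemma poly_decay_conv (p : nat) (f g : fps) :
  geo_decay f -> poly_decay p g -> poly_decay p (f * g)%fps.
Proof.
  intros Hf Hg. apply poly_decay_nonneg in Hg. destruct Hg as (K & HK & Hg).
  assert (Hw : geo_decay (fun n => INR (S n) ^ p * f n)).
  { clear - Hf. induction p as [|p IH].
    - revert Hf. apply geo_decay_le. intros n. rewrite pow_O, Rmult_1_l. apply Rle_refl.
    - apply geo_decay_weight in IH. revert IH. apply geo_decay_le. intros n.
      cbn [pow]. rewrite Rmult_assoc. apply Rle_refl. }
  destruct (geo_decay_sum _ Hw) as (B & HB & HBn). exists (K * B). intros n.
  unfold fmul. eapply Rle_trans; [apply Rsum_abs|].
  eapply Rle_trans; [apply (sum_Rle _ (fun i => K / INR (S n) ^ p *
    Rabs (INR (S i) ^ p * f i)))|].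
  - intros i Hi. rewrite !Rabs_mult.
    rewrite (Rabs_right (INR (S i) ^ p)) by (apply Rle_ge, pow_le, Rlt_le, INR_S_pos).
    pose proof (Rabs_pos (f i)). rewrite Rmult_comm, <- Rmult_assoc.
    apply Rmult_le_compat_r; [assumption|]. eapply Rle_trans; [apply Hg|].
    pose proof (pow_lt _ p (INR_S_pos (n - i))). pose proof (pow_lt _ p (INR_S_pos n)).
    assert (INR (S n) ^ p <= INR (S i) ^ p * INR (S (n - i)) ^ p).
    { rewrite <- Rpow_mult_distr. apply pow_incr. split; [apply Rlt_le, INR_S_pos|].
      rewrite <- mult_INR. apply le_INR. nia. }
    unfold Rdiv. rewrite Rmult_assoc. apply Rmult_le_compat_l; [exact HK|].
    apply (Rmult_le_reg_r (INR (S (n - i)) ^ p)); [assumption|]. rewrite Rinv_l by lra.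
    apply (Rmult_le_reg_l (INR (S n) ^ p)); [assumption|]. rewrite Rmult_1_r.
    replace (INR (S n) ^ p * (/ INR (S n) ^ p * INR (S i) ^ p * INR (S (n - i)) ^ p))
      with (INR (S i) ^ p * INR (S (n - i)) ^ p) by (field; lra).
    assumption.
  - rewrite sum_f_R0_scal. replace (K * B / INR (S n) ^ p) with (K / INR (S n) ^ p * B)
      by (unfold Rdiv; ring).
    apply Rmult_le_compat_l; [|apply HBn].
    apply Rdiv_le_0_compat; [exact HK | apply pow_lt, INR_S_pos].
Qed.

Lemma finite_bound (f : fps) (J : nat) :
  exists M, 1 <= M /\ forall i, (i <= J)%nat -> Rabs (f i) <= M.
Proof.
  induction J as [|J (M & HM & H)].
  - exists (1 + Rabs (f 0%nat)). pose proof (Rabs_pos (f 0%nat)). split; [lra|].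
    intros i Hi. replace i with 0%nat by lia. lra.
  - exists (M + Rabs (f (S J))). pose proof (Rabs_pos (f (S J))). split; [lra|].
    intros i Hi. destruct (Nat.eq_dec i (S J)) as [->|Hne]; [lra|].
    specialize (H i ltac:(lia)). lra.
Qed.

(** Recurrences bound the coefficient of index n + 1 in terms of n; the loss 2^p comes from n + 2 <=
    2 (n + 1). *)
Lemma poly_decay_tail (p : nat) (f : fps) :
  poly_decay p (fun n => f (S n)) -> poly_decay p f.
Proof.
  intros H. apply poly_decay_nonneg in H. destruct H as (K & HK & H).
  exists (Rabs (f 0%nat) + K * 2 ^ p). intros [|n].
  - simpl INR. rewrite pow1. unfold Rdiv. rewrite Rinv_1.
    assert (0 < 2 ^ p) by (apply pow_lt; lra). nra.
  - eapply Rle_trans; [apply H|]. pose proof (pow_lt _ p (INR_S_pos (S n))).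
    pose proof (pow_lt _ p (INR_S_pos n)).
    assert (INR (S (S n)) ^ p <= 2 ^ p * INR (S n) ^ p).
    { rewrite <- Rpow_mult_distr. apply pow_incr. split; [apply Rlt_le, INR_S_pos|].
      rewrite (S_INR (S n)), (S_INR n). pose proof (pos_INR n). lra. }
    apply (Rmult_le_reg_r (INR (S (S n)) ^ p)); [assumption|].
    unfold Rdiv. rewrite (Rmult_assoc (_ + _)), Rinv_l, Rmult_1_r by lra.
    apply Rle_trans with (K * 2 ^ p).
    + apply (Rmult_le_reg_r (INR (S n) ^ p)); [assumption|].
      replace (K * / INR (S n) ^ p * INR (S (S n)) ^ p * INR (S n) ^ p) with
        (K * INR (S (S n)) ^ p) by (field; lra).
      rewrite Rmult_assoc. apply Rmult_le_compat_l; assumption.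
    + pose proof (Rabs_pos (f 0%nat)). lra.
Qed.

(** * Convergence *)

(** B telescopes over the tail, which yields convergence by the Cauchy criterion and its rate at
    once. *)
Lemma telescoping_tail (a B : nat -> R) :
  (forall n, Rabs (a (S n)) <= B n - B (S n)) -> (forall n, 0 <= B n) ->
  is_lim_seq B 0 ->
  exists l, is_series a l /\ forall n, Rabs (sum_f_R0 a n - l) <= B n.
Proof.
  intros Ha HB HL.
  assert (Hd : forall n d, Rabs (sum_f_R0 a (n + d) - sum_f_R0 a n) <= B n - B (n + d)%nat).
  { intros n d. induction d as [|d IH].
    - rewrite Nat.add_0_r, !Rminus_diag, Rabs_R0. lra.
    - rewrite Nat.add_succ_r, tech5. specialize (Ha (n + d)%nat).
      replace (sum_f_R0 a (n + d) + a (S (n + d)) - sum_f_R0 a n) with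
        ((sum_f_R0 a (n + d) - sum_f_R0 a n) + a (S (n + d))) by ring.
      eapply Rle_trans; [apply Rabs_triang|]. lra. }
  assert (Hcv : ex_finite_lim_seq (sum_f_R0 a)).
  { apply ex_lim_seq_cauchy_corr. intros e.
    apply is_lim_seq_spec in HL. specialize (HL (mkposreal _ (is_pos_div_2 e))).
    destruct HL as [n0 HN]. cbn in HN. exists n0. intros n m Hn Hm.
    pose proof (Hd n0 (n - n0)%nat) as H1. pose proof (Hd n0 (m - n0)%nat) as H2.
    replace (n0 + (n - n0))%nat with n in H1 by lia.
    replace (n0 + (m - n0))%nat with m in H2 by lia.
    pose proof (HB n). pose proof (HB m). specialize (HN n0 (le_n _)).
    rewrite Rminus_0_r, Rabs_right in HN by (apply Rle_ge, HB).
    replace (sum_f_R0 a n - sum_f_R0 a m) with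
      ((sum_f_R0 a n - sum_f_R0 a n0) - (sum_f_R0 a m - sum_f_R0 a n0)) by ring.
    eapply Rle_lt_trans; [apply Rabs_triang|]. rewrite Rabs_Ropp. lra. }
  destruct Hcv as [l Hl]. exists l. split.
  - apply is_series_Reals. apply is_lim_seq_Reals in Hl. exact Hl.
  - intros n.
    assert (K : is_lim_seq (fun d => Rabs (sum_f_R0 a n - sum_f_R0 a (d + n)))
                  (Rabs (sum_f_R0 a n - l))).
    { apply (is_lim_seq_abs _ (Finite (sum_f_R0 a n - l))).
      apply is_lim_seq_minus'; [apply is_lim_seq_const|].
      apply (is_lim_seq_incr_n (sum_f_R0 a) n), Hl. }
    apply (is_lim_seq_le _ (fun _ => B n) (Rabs (sum_f_R0 a n - l)) (B n)) in K;
      [exact K| |apply is_lim_seq_const].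
    intros d. rewrite Rabs_minus_sym, (Nat.add_comm d n). pose proof (Hd n d).
    pose proof (HB (n + d)%nat). lra.
Qed.

Lemma is_lim_seq_scal_0 (K : R) (u : nat -> R) :
  is_lim_seq u 0 -> is_lim_seq (fun n => K * u n) 0.
Proof.
  intros H. replace (Finite 0) with (Finite (K * 0)) by (f_equal; ring).
  apply (is_lim_seq_scal_l u K 0 H).
Qed.

(** Comparison of 1 / (n + 2)^2 with 1 / (n + 1) - 1 / (n + 2). *)
Lemma poly_decay_series (a : fps) : poly_decay 2 a ->
  exists l, is_series a l /\ poly_decay 1 (fun n => sum_f_R0 a n - l).
Proof.
  intros H. apply poly_decay_nonneg in H. destruct H as (K & HK & H).
  destruct (telescoping_tail a (fun n => K * / INR (S n))) as (l & Hl & Ht).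
  - intros n. eapply Rle_trans; [apply H|].
    pose proof (INR_S_pos n). rewrite (S_INR (S n)). set (x := INR (S n)) in *.
    replace (K * / x - K * / (x + 1)) with (K * (/ (x * (x + 1)))) by (field; lra).
    unfold Rdiv. apply Rmult_le_compat_l; [exact HK|]. apply Rinv_le_contravar; nra.
  - intros n. apply Rmult_le_pos; [exact HK|]. apply Rlt_le, Rinv_0_lt_compat, INR_S_pos.
  - apply is_lim_seq_scal_0. apply is_lim_seq_spec. intros e. cbn.
    generalize (recipN_small e (cond_pos e)). apply filter_imp. intros n Hn.
    unfold recipN in Hn. rewrite Nat.add_1_r in Hn.
    rewrite Rminus_0_r, Rabs_right; [exact Hn|]. apply Rle_ge, Rlt_le, Rinv_0_lt_compat, INR_S_pos.
  - exists l. split; [exact Hl|]. exists K. intros n. rewrite pow_1. apply Ht.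
Qed.

Lemma geo_decay_series (a : fps) : geo_decay a ->
  exists l, is_series a l /\ geo_decay (fun n => sum_f_R0 a n - l).
Proof.
  intros (K & r & HK & Hr & H).
  assert (Hi : 0 < / (1 - r)) by (apply Rinv_0_lt_compat; lra).
  destruct (telescoping_tail a (fun n => K / (1 - r) * r ^ n)) as (l & Hl & Ht).
  - intros n. eapply Rle_trans; [apply H|].
    replace (K / (1 - r) * r ^ n - K / (1 - r) * r ^ S n) with (K * r ^ n)
      by (simpl; field; lra).
    simpl. assert (0 < r ^ n) by (apply pow_lt; lra).
    apply Rmult_le_compat_l; [exact HK|]. nra.
  - intros n. apply Rmult_le_pos; [apply Rdiv_le_0_compat; lra | apply pow_le; lra].
  - apply is_lim_seq_scal_0. apply is_lim_seq_geom. rewrite Rabs_right; lra.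
  - exists l. split; [exact Hl|]. exists (K / (1 - r)), r.
    split; [apply Rdiv_le_0_compat; lra|]. split; [exact Hr | exact Ht].
Qed.

Lemma poly_decay_ex_abs (a : fps) : poly_decay 2 a -> ex_series (fun n => Rabs (a n)).
Proof.
  intros [K H]. destruct (poly_decay_series (fun n => Rabs (a n))) as (l & Hl & _).
  - exists K. intros n. rewrite Rabs_Rabsolu. apply H.
  - exists l. exact Hl.
Qed.

(** * The trigonometric coefficient sequences *)

(** The series 1 / (1 - s); multiplying by it takes partial sums. *)
Definition ones : fps := fun _ => 1.

Lemma ones_mulE (f : fps) (n : nat) : (f * ones)%fps n = sum_f_R0 f n.
Proof. unfold fmul, ones. apply sum_eq. intros; ring. Qed.

Lemma ones_inv : ((fC 1 - fX) * ones)%fps = fC 1.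
Proof.
  replace ((fC 1 - fX) * ones)%fps with (ones - fX * ones)%fps by ring.
  extensionality n. unfold fsub. destruct n as [|n].
  - rewrite fX_mulE0. unfold ones. simpl. ring.
  - rewrite fX_mulE. unfold ones. simpl. ring.
Qed.

Lemma sub_fX_mulE (f : fps) (n : nat) : ((fC 1 - fX) * f)%fps (S n) = f (S n) - f n.
Proof.
  replace ((fC 1 - fX) * f)%fps with (f - fX * f)%fps by ring.
  unfold fsub. rewrite fX_mulE. reflexivity.
Qed.

Lemma sub_fX_mulE0 (f : fps) : ((fC 1 - fX) * f)%fps 0%nat = f 0%nat.
Proof. rewrite fmul_0. unfold fsub. simpl. ring. Qed.

Lemma is_series_cos (x : R) :
  is_series (fun k => (- x ^ 2) ^ k / INR (fact (2 * k))) (cos x).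
Proof.
  apply is_series_Reals. unfold cos. destruct (exist_cos (Rsqr x)) as [l Hl].
  unfold cos_in in Hl. intros e He. destruct (Hl e He) as [n0 H]. exists n0. intros n Hn.
  rewrite (sum_eq _ (fun i => cos_n i * (Rsqr x) ^ i)); [exact (H n Hn)|].
  intros i _. unfold cos_n. replace (- x ^ 2) with (-1 * Rsqr x) by (unfold Rsqr; ring).
  rewrite Rpow_mult_distr. unfold Rdiv. ring.
Qed.

Lemma is_series_sin (x : R) :
  is_series (fun k => x * ((- x ^ 2) ^ k / INR (fact (S (2 * k))))) (sin x).
Proof.
  unfold sin. destruct (exist_sin (Rsqr x)) as [l Hl].
  apply (is_series_scal_l x (fun k => (- x ^ 2) ^ k / INR (fact (S (2 * k)))) l).
  apply is_series_Reals.
  unfold sin_in in Hl. intros e He. destruct (Hl e He) as [n0 H]. exists n0. intros n Hn.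
  rewrite (sum_eq _ (fun i => sin_n i * (Rsqr x) ^ i)); [exact (H n Hn)|].
  intros i _. unfold sin_n. replace (- x ^ 2) with (-1 * Rsqr x) by (unfold Rsqr; ring).
  rewrite Rpow_mult_distr, Nat.add_1_r. unfold Rdiv. ring.
Qed.

Lemma PI_le : PI <= 68 / 21.
Proof.
  (* First upper bound from the alternating series of PI / 4 = 2 atan (1/3) + atan (1/7): PI / 4 <=
     2/3 + 1/7 = 17/21. *)
  destruct (PI_2_3_7_ineq 0) as [_ H]. simpl in H. unfold PI_2_3_7_tg, Ratan_seq, tg_alt in H.
  simpl in H. lra.
Qed.

(** (34/21)^2 rounded up; the numerical ratios below come from 2.63. *)
Lemma halfPI_sq : 0 < (PI / 2) ^ 2 <= 2.63.
Proof. pose proof PI_le. pose proof PI_RGT_0. split; nra. Qed.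

(** Successive ratios are at most 2.63 / 6 < 9/20. A value below 1/2 is what [finv_geometric] with K
    = 1 asks for. *)
Lemma sincH_geometric (n : nat) : Rabs (sincH n) <= (9 / 20) ^ n.
Proof.
  induction n as [|n IH].
  - rewrite sincH_0, Rabs_R1. simpl. lra.
  - pose proof halfPI_sq as Hp. set (p := (PI / 2) ^ 2) in *.
    replace (sincH (S n)) with
      (sincH n * (- p / (INR (S (S (2 * n))) * INR (S (S (S (2 * n))))))).
    + rewrite Rabs_mult. cbn [pow]. rewrite Rmult_comm.
      apply Rmult_le_compat; try apply Rabs_pos; [|exact IH].
      unfold Rdiv. rewrite Rabs_mult, Rabs_Ropp, Rabs_right by lra.
      assert (6 <= INR (S (S (2 * n))) * INR (S (S (S (2 * n))))).
      { rewrite !S_INR, mult_INR. pose proof (pos_INR n). simpl. nra. }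
      rewrite Rabs_right by (apply Rle_ge, Rlt_le, Rinv_0_lt_compat; lra).
      assert (/ (INR (S (S (2 * n))) * INR (S (S (S (2 * n))))) <= / 6)
        by (apply Rinv_le_contravar; lra).
      assert (0 < / (INR (S (S (2 * n))) * INR (S (S (S (2 * n))))))
        by (apply Rinv_0_lt_compat; lra).
      nra.
    + unfold sincH. fold p. replace (S (2 * S n)) with (S (S (S (2 * n)))) by lia.
      rewrite (fact_simpl (S (S (2 * n)))), (fact_simpl (S (2 * n))), !mult_INR.
      cbn [pow]. pose proof (INR_fact_neq_0 (S (2 * n))).
      pose proof (INR_S_pos (S (2 * n))). pose proof (INR_S_pos (S (S (2 * n)))).
      field. repeat split; lra.
Qed.

(** 1.315 is 2.63 / 2, and the later ratios are at most 2.63 / 12 < 1/4. *)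
Lemma cosH_geometric (n : nat) : Rabs (cosH (S n)) <= 1.315 * (/ 4) ^ n.
Proof.
  pose proof halfPI_sq as Hp.
  induction n as [|n IH].
  - replace (cosH 1%nat) with (- ((PI / 2) ^ 2 / 2)) by (unfold cosH; simpl; field).
    rewrite Rabs_Ropp, pow_O, Rabs_right; lra.
  - set (p := (PI / 2) ^ 2) in *.
    replace (cosH (S (S n))) with
      (cosH (S n) * (- p / (INR (S (2 * S n)) * INR (S (S (2 * S n)))))).
    + rewrite Rabs_mult. cbn [pow]. rewrite Rmult_comm.
      replace (1.315 * (/ 4 * (/ 4) ^ n)) with (/ 4 * (1.315 * (/ 4) ^ n)) by ring.
      apply Rmult_le_compat; try apply Rabs_pos; [|exact IH].
      unfold Rdiv. rewrite Rabs_mult, Rabs_Ropp, Rabs_right by lra.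
      assert (12 <= INR (S (2 * S n)) * INR (S (S (2 * S n)))).
      { rewrite (S_INR (S (2 * S n))), (S_INR (2 * S n)), mult_INR, (S_INR n).
        pose proof (pos_INR n). simpl. nra. }
      rewrite Rabs_right by (apply Rle_ge, Rlt_le, Rinv_0_lt_compat; lra).
      assert (/ (INR (S (2 * S n)) * INR (S (S (2 * S n)))) <= / 12)
        by (apply Rinv_le_contravar; lra).
      assert (0 < / (INR (S (2 * S n)) * INR (S (S (2 * S n)))))
        by (apply Rinv_0_lt_compat; lra).
      nra.
    + unfold cosH. fold p. replace (2 * S (S n))%nat with (S (S (2 * S n))) by lia.
      rewrite (fact_simpl (S (2 * S n))), (fact_simpl (2 * S n)), !mult_INR.
      change ((- p) ^ S (S n)) with (- p * (- p) ^ S n).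
      pose proof (INR_fact_neq_0 (2 * S n)).
      pose proof (INR_S_pos (2 * S n)). pose proof (INR_S_pos (S (2 * S n))).
      field. repeat split; lra.
Qed.

(* [cosH / (1 - s)]: removing the zero of [cos (PI x / 2)] at [x = 1]. *)
Definition cosQ : fps := (cosH * ones)%fps.

Lemma cosH_cosQ : cosH = ((fC 1 - fX) * cosQ)%fps.
Proof.
  unfold cosQ. transitivity (cosH * ((fC 1 - fX) * ones))%fps; [rewrite ones_inv|]; ring.
Qed.

Lemma is_series_cosH : is_series cosH 0.
Proof.
  rewrite <- cos_PI2. apply is_series_cos.
Qed.

(** As [cosH] sums to cos (PI / 2) = 0, its partial sums are minus its tails; 1.754 exceeds 1.315 /
    (1 - 1/4). *)
Lemma cosQ_geometric (n : nat) : Rabs (cosQ n) <= 1.754 * (/ 4) ^ n.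
Proof.
  destruct (telescoping_tail cosH (fun n => 1.754 * (/ 4) ^ n)) as (l & Hl & Ht).
  - intros k. eapply Rle_trans; [apply cosH_geometric|]. simpl.
    assert (0 < (/ 4) ^ k) by (apply pow_lt; lra). lra.
  - intros k. assert (0 < (/ 4) ^ k) by (apply pow_lt; lra). lra.
  - apply is_lim_seq_scal_0, is_lim_seq_geom. rewrite Rabs_right; lra.
  - assert (l = 0).
    { rewrite <- (is_series_unique _ _ Hl). apply is_series_unique, is_series_cosH. }
    subst l. specialize (Ht n). unfold cosQ. rewrite ones_mulE.
    rewrite Rminus_0_r in Ht. exact Ht.
Qed.

Lemma cosQ_0 : cosQ 0%nat = 1.
Proof. unfold cosQ. rewrite fmul_0, cosH_0. unfold ones. ring. Qed.

Lemma geo_decay_sincH : geo_decay sincH.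
Proof.
  exists 1, (9 / 20). split; [lra|]. split; [lra|]. intros n. rewrite Rmult_1_l.
  apply sincH_geometric.
Qed.

Lemma geo_decay_cosQ : geo_decay cosQ.
Proof. exists 1.754, (/ 4). split; [lra|]. split; [lra|]. apply cosQ_geometric. Qed.

(** The ratio 9/10 < 1 expresses, without complex analysis, that [sincH] has no zero in the closed
    unit disc of s. *)
Lemma geo_decay_finv_sincH : geo_decay (finv sincH).
Proof.
  exists 1, (9 / 20 * (1 + 1)). split; [lra|]. split; [lra|]. intros n. rewrite Rmult_1_l.
  apply finv_geometric; [lra | lra | exact sincH_0 |].
  intros k. rewrite Rmult_1_l. apply sincH_geometric.
Qed.

(** The ratio (1 + 1.754) / 4 is less than 1; the nearest zero left is x = 3, outside the disc. *)
Lemma geo_decay_finv_cosQ : geo_decay (finv cosQ).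
Proof.
  exists 1, (/ 4 * (1 + 1.754)). split; [lra|]. split; [lra|]. intros n. rewrite Rmult_1_l.
  apply finv_geometric; [lra | lra | exact cosQ_0 |].
  intros k. apply cosQ_geometric.
Qed.

Lemma finv_unique (f g : fps) : f 0%nat = 1 -> (f * g)%fps = fC 1 -> finv f = g.
Proof.
  intros H0 H. transitivity ((f * g) * finv f)%fps; [rewrite H; ring|].
  transitivity ((f * finv f) * g)%fps; [ring|]. rewrite finv_mul by exact H0. ring.
Qed.

(** Isolates the simple pole of 1 / cos at s = 1. The partial summation by [ones] is the source of
    the logarithm in the odd coefficients. *)
Lemma finv_cosH : finv cosH = (finv cosQ * ones)%fps.
Proof.
  apply finv_unique; [exact cosH_0|]. rewrite cosH_cosQ.
  transitivity ((cosQ * finv cosQ) * ((fC 1 - fX) * ones))%fps; [ring|].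
  rewrite ones_inv, finv_mul by exact cosQ_0. ring.
Qed.

Lemma geo_decay_ex_abs (a : fps) : geo_decay a -> ex_series (fun n => Rabs (a n)).
Proof. intros H. apply poly_decay_ex_abs, geo_poly_decay, H. Qed.

Lemma is_series_fmul (a b : fps) (la lb : R) :
  is_series a la -> is_series b lb ->
  ex_series (fun n => Rabs (a n)) -> ex_series (fun n => Rabs (b n)) ->
  is_series (a * b)%fps (la * lb).
Proof. apply is_series_mult. Qed.

Lemma is_series_C (x : R) : is_series (fC x) x.
Proof.
  apply is_series_Reals. intros e He. exists 0%nat. intros n _.
  rewrite sum_f_R0_head by reflexivity. simpl. rewrite R_dist_eq. exact He.
Qed.

Lemma is_series_finv (a : fps) (l : R) : a 0%nat = 1 -> is_series a l ->
  geo_decay a -> geo_decay (finv a) -> l <> 0 -> is_series (finv a) (/ l).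
Proof.
  intros H0 Ha Ga Gi Hl. destruct (geo_decay_series _ Gi) as (m & Hm & _).
  pose proof (is_series_fmul _ _ _ _ Ha Hm (geo_decay_ex_abs _ Ga) (geo_decay_ex_abs _ Gi)) as H.
  rewrite finv_mul in H by exact H0.
  apply is_series_unique in H. rewrite (is_series_unique _ _ (is_series_C 1)) in H.
  replace (/ l) with m; [exact Hm|]. apply (Rmult_eq_reg_l l); [|exact Hl].
  rewrite Rinv_r by exact Hl. symmetry. exact H.
Qed.

Lemma is_series_sincH : is_series sincH (2 / PI).
Proof.
  pose proof PI_RGT_0. destruct (geo_decay_series _ geo_decay_sincH) as (l & Hl & _).
  pose proof (is_series_sin (PI / 2)) as Hs. rewrite sin_PI2 in Hs.
  pose proof (is_series_scal_l (PI / 2) sincH l Hl) as Hl'.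
  apply is_series_unique in Hs. apply is_series_unique in Hl'.
  replace (2 / PI) with l; [exact Hl|].
  apply (Rmult_eq_reg_l (PI / 2)); [|lra]. transitivity 1; [|field; lra].
  rewrite <- Hs. symmetry. exact Hl'.
Qed.

Lemma theta_cosH : theta cosH = (fC (- (PI ^ 2 / 8)) * (fX * sincH))%fps.
Proof.
  extensionality n. rewrite fC_mulE. unfold theta. destruct n as [|n].
  - rewrite fX_mulE0. simpl. ring.
  - rewrite fX_mulE. unfold cosH, sincH.
    replace (2 * S n)%nat with (S (S (2 * n))) by lia.
    rewrite (fact_simpl (S (2 * n))), mult_INR.
    replace (INR (S (S (2 * n)))) with (2 * INR (S n))
      by (rewrite !S_INR, mult_INR; simpl; ring).
    cbn [pow]. pose proof (INR_fact_neq_0 (S (2 * n))). pose proof (INR_S_pos n).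
    field. split; lra.
Qed.

Lemma is_series_fX (a : fps) (l : R) : is_series a l -> is_series (fX * a)%fps l.
Proof.
  intros H. apply is_series_decr_1.
  match goal with |- is_series _ ?z =>
    replace z with l by (rewrite fX_mulE0; unfold plus, opp; simpl; ring) end.
  revert H. apply is_series_ext. intros n. symmetry. apply fX_mulE.
Qed.

(** The value at s = 1 is minus the derivative of [cosH] there: [theta cosH] is (1 - s) [theta cosQ]
    - s [cosQ], and by [theta_cosH] it sums to -(PI^2 / 8) (2 / PI). *)
Lemma is_series_cosQ : is_series cosQ (PI / 4).
Proof.
  pose proof PI_RGT_0. destruct (geo_decay_series _ geo_decay_cosQ) as (l & Hl & _).
  destruct (geo_decay_series _ (geo_decay_theta _ geo_decay_cosQ)) as (m & Hm & _).
  assert (E : theta cosH = (theta cosQ - fX * theta cosQ - fX * cosQ)%fps).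
  { rewrite cosH_cosQ at 1. rewrite theta_mul, theta_sub, theta_C, theta_X. ring. }
  assert (H1 : is_series (theta cosH) (- l)).
  { rewrite E.
    replace (- l) with (m + - m + - l) by ring.
    apply (is_series_minus (V := R_NormedModule));
      [apply (is_series_minus (V := R_NormedModule))|];
      try apply is_series_fX; assumption. }
  assert (H2 : is_series (theta cosH) (- (PI ^ 2 / 8) * (2 / PI))).
  { rewrite theta_cosH.
    apply (is_series_ext (fun n => - (PI ^ 2 / 8) * (fX * sincH)%fps n)).
    - intros n. rewrite fC_mulE. reflexivity.
    - apply (is_series_scal_l (- (PI ^ 2 / 8)) (fX * sincH)%fps).
      apply is_series_fX, is_series_sincH. }
  apply is_series_unique in H1. apply is_series_unique in H2. rewrite H1 in H2.
  assert (E' : l = PI / 4).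
  { apply (Rmult_eq_reg_l (-1)); [|lra]. transitivity (- l); [ring|].
    transitivity (- (PI ^ 2 / 8) * (2 / PI)); [exact H2|]. field. lra. }
  rewrite <- E'. exact Hl.
Qed.

(** * Coefficients of the Legendre function *)

(** sin (PI x) / (PI x (1 - x^2)). Since 2 [theta] is x d/dx when s = x^2, the next series is x
    times its logarithmic derivative. *)
Definition kernelQ : fps := (sincH * cosQ)%fps.
Definition kernelQ_log : fps :=
  (fC 2 * (theta kernelQ * (finv sincH * finv cosQ)))%fps.

Lemma kernelQ_inv : (kernelQ * (finv sincH * finv cosQ))%fps = fC 1.
Proof.
  unfold kernelQ.
  transitivity ((sincH * finv sincH) * (cosQ * finv cosQ))%fps; [ring|].
  rewrite !finv_mul by (apply sincH_0 || apply cosQ_0). ring.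
Qed.

Lemma sincH_cosH_kernelQ : (sincH * cosH)%fps = ((fC 1 - fX) * kernelQ)%fps.
Proof. rewrite cosH_cosQ. unfold kernelQ. ring. Qed.

Lemma geo_decay_kernelQ : geo_decay kernelQ.
Proof. apply geo_decay_mul; [exact geo_decay_sincH | exact geo_decay_cosQ]. Qed.

Lemma geo_decay_kernelQ_log : geo_decay kernelQ_log.
Proof.
  apply geo_decay_scal, geo_decay_mul; [apply geo_decay_theta, geo_decay_kernelQ|].
  apply geo_decay_mul; [exact geo_decay_finv_sincH | exact geo_decay_finv_cosQ].
Qed.

Lemma kernelQ_log_0 : kernelQ_log 0%nat = 0.
Proof. unfold kernelQ_log. rewrite fC_mulE, fmul_0. unfold theta. simpl. ring. Qed.

(** Dividing by [kernelQ] keeps only the factor 1 - s of the weight; everything else enters through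
    [kernelQ_log], which decays geometrically. *)
Lemma legendre_delta (y : fps) (k0 : R) :
  (fC 4 * theta (sincH * cosH * theta y) = fC k0 * (fX * (sincH * cosH * y)))%fps ->
  let d := ((fC 1 - fX) * (fC 2 * theta y))%fps in
  (fC 2 * theta d = fC k0 * (fX * ((fC 1 - fX) * y)) - kernelQ_log * d)%fps.
Proof.
  intros H d.
  assert (E : (fC 2 * theta (kernelQ * d) = kernelQ * (fC k0 * (fX * ((fC 1 - fX) * y))))%fps).
  { transitivity (fC 4 * theta (sincH * cosH * theta y))%fps.
    - rewrite sincH_cosH_kernelQ. unfold d.
      replace (kernelQ * ((fC 1 - fX) * (fC 2 * theta y)))%fps with
        (fC 2 * ((fC 1 - fX) * kernelQ * theta y))%fps by ring.
      replace (fC 4) with (fC 2 * fC 2)%fps by (rewrite fC_mul; f_equal; ring).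
      rewrite (theta_mul (fC 2)), theta_C. ring.
    - rewrite H, sincH_cosH_kernelQ. ring. }
  clearbody d. clear H. rewrite theta_mul in E.
  set (r := (fC k0 * (fX * ((fC 1 - fX) * y)))%fps) in *.
  pose proof kernelQ_inv as Hi. unfold kernelQ_log.
  set (qi := (finv sincH * finv cosQ)%fps) in *.
  transitivity ((kernelQ * qi) * (fC 2 * theta d))%fps; [rewrite Hi; ring|].
  transitivity (qi * (fC 2 * (theta kernelQ * d + kernelQ * theta d)) -
    fC 2 * (theta kernelQ * qi) * d)%fps; [ring|].
  rewrite E. transitivity ((kernelQ * qi) * r - fC 2 * (theta kernelQ * qi) * d)%fps; [ring|].
  rewrite Hi. ring.
Qed.

(** * Decay of the coefficients of y, improved step by step *)

Section Bootstrap.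

Variables (y eta : fps) (k0 : R).
Let z : fps := (fC 2 * theta y)%fps.
Let d : fps := ((fC 1 - fX) * z)%fps.
Hypothesis eta_decay : geo_decay eta.
Hypothesis eta_0 : eta 0%nat = 0.
Hypothesis delta_eq :
  (fC 2 * theta d = fC k0 * (fX * ((fC 1 - fX) * y)) - eta * d)%fps.

Lemma z_coef n : z n = 2 * INR n * y n.
Proof. unfold z. rewrite fC_mulE. unfold theta. ring. Qed.

Lemma delta_coef j :
  2 * INR (S j) * d (S j) = k0 * ((fC 1 - fX) * y)%fps j - (eta * d)%fps (S j).
Proof.
  pose proof (f_equal (fun h => h (S j)) delta_eq) as H. unfold fsub at 1 in H.
  cbv beta in H. rewrite !fC_mulE, fX_mulE in H. unfold theta in H at 1.
  rewrite <- Rmult_assoc in H. exact H.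
Qed.

Lemma delta_0 : d 0%nat = 0.
Proof. unfold d. rewrite sub_fX_mulE0, z_coef. simpl. ring. Qed.

Lemma z_sum_delta n : z n = sum_f_R0 d n.
Proof.
  induction n as [|n IH].
  - cbn [sum_f_R0]. rewrite delta_0, z_coef. simpl. ring.
  - rewrite tech5, <- IH. unfold d. rewrite sub_fX_mulE. ring.
Qed.

Lemma z_linear (M : R) n : (forall i, (i <= n)%nat -> Rabs (d i) <= M) ->
  Rabs (z n) <= INR n * M.
Proof.
  induction n as [|n IH]; intros H.
  - rewrite z_coef. simpl. rewrite Rmult_0_r, Rmult_0_l, Rabs_R0. lra.
  - rewrite z_sum_delta, tech5, <- z_sum_delta, S_INR.
    eapply Rle_trans; [apply Rabs_triang|].
    assert (Rabs (z n) <= INR n * M) by (apply IH; intros; apply H; lia).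
    specialize (H (S n) (le_n _)). lra.
Qed.

Lemma y_bounded_by (M : R) n : Rabs (y 0%nat) <= M ->
  (forall i, (i <= n)%nat -> Rabs (d i) <= M) -> Rabs (y n) <= M.
Proof.
  intros H0 H. destruct n as [|n]; [exact H0|].
  apply z_linear in H. rewrite z_coef, !Rabs_mult, (Rabs_right 2), Rabs_right in H
    by (try lra; apply Rle_ge, pos_INR).
  pose proof (INR_S_pos n). pose proof (Rabs_pos (y (S n))).
  apply (Rmult_le_reg_l (INR (S n))); [assumption|]. nra.
Qed.

(** Strong induction on [delta_coef]: its right side is at most (2 |k0| + B) M while its left side
    carries 2 (j + 1), so beyond a fixed J the bound M reproduces itself. *)
Lemma delta_bounded : exists M, 0 <= M /\ Rabs (y 0%nat) <= M /\ (forall i, Rabs (d i) <= M).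
Proof.
  destruct (geo_decay_sum _ eta_decay) as (B & HB & HBn).
  destruct (INR_archimed 1 ((B + Rabs k0 * 2) / 2)) as [J HJ]; [lra|].
  destruct (finite_bound d J) as (M0 & HM0 & HdJ).
  set (M := M0 + Rabs (y 0%nat)).
  pose proof (Rabs_pos (y 0%nat)) as Hy0.
  exists M. split; [unfold M; lra|]. split; [unfold M; lra|].
  intros i. apply (well_founded_induction Wf_nat.lt_wf) with (a := i). clear i.
  intros i IH. destruct (le_lt_dec i J) as [Hi|Hi].
  - unfold M. specialize (HdJ i Hi). lra.
  - destruct i as [|j]; [lia|].
    assert (Hj : forall i, (i <= j)%nat -> Rabs (d i) <= M) by (intros; apply IH; lia).
    assert (Hv : Rabs (((fC 1 - fX) * y)%fps j) <= 2 * M).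
    { destruct j as [|j].
      - rewrite sub_fX_mulE0. unfold M. lra.
      - rewrite sub_fX_mulE. unfold Rminus. eapply Rle_trans; [apply Rabs_triang|].
        rewrite Rabs_Ropp.
        assert (Rabs (y (S j)) <= M) by (apply y_bounded_by; [unfold M; lra | exact Hj]).
        assert (Rabs (y j) <= M)
          by (apply y_bounded_by; [unfold M; lra | intros; apply Hj; lia]).
        lra. }
    assert (He : Rabs ((eta * d)%fps (S j)) <= B * M).
    { unfold fmul. eapply Rle_trans; [apply Rsum_abs|].
      eapply Rle_trans; [apply (sum_Rle _ (fun i => M * Rabs (eta i)))|].
      - intros [|i] Hi'.
        (* [eta_0] removes d (S j) from the convolution, so that only earlier terms occur. *)
        + rewrite eta_0, Rmult_0_l, Rabs_R0. lra.
        + rewrite Rabs_mult, Rmult_comm. apply Rmult_le_compat_r; [apply Rabs_pos|].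
          apply Hj. lia.
      - rewrite sum_f_R0_scal. specialize (HBn (S j)). unfold M in *. nra. }
    pose proof (delta_coef j) as E. apply (f_equal Rabs) in E.
    rewrite !Rabs_mult, (Rabs_right 2), (Rabs_right (INR (S j))) in E
      by (try lra; apply Rle_ge, pos_INR).
    assert (Hr : 2 * INR (S j) * Rabs (d (S j)) <= (Rabs k0 * 2 + B) * M).
    { rewrite E. eapply Rle_trans; [apply Rabs_triang|]. rewrite Rabs_Ropp, Rabs_mult.
      pose proof (Rabs_pos k0). nra. }
    assert (HJ' : (B + Rabs k0 * 2) / 2 <= INR (S j)).
    { assert (INR J <= INR (S j)) by (apply le_INR; lia). lra. }
    pose proof (INR_S_pos j). assert (0 <= M) by (unfold M; lra).
    apply (Rmult_le_reg_l (2 * INR (S j))); [lra|].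
    eapply Rle_trans; [exact Hr|]. apply Rmult_le_compat_r; lra.
Qed.

(** Dividing [delta_coef] by 2 (j + 1) gains one power, provided the differences of y decay to order
    p. *)
Lemma delta_step (p : nat) : poly_decay p ((fC 1 - fX) * y)%fps -> poly_decay p d ->
  poly_decay (S p) d.
Proof.
  intros Hy Hd. pose proof (poly_decay_conv p eta d eta_decay Hd) as He.
  apply poly_decay_nonneg in Hy. destruct Hy as (K & HK & Hy).
  apply poly_decay_nonneg in He. destruct He as (K' & HK' & He).
  apply poly_decay_tail. exists (Rabs k0 * K + K'). intros j.
  pose proof (delta_coef j) as E. apply (f_equal Rabs) in E.
  rewrite !Rabs_mult, (Rabs_right 2), (Rabs_right (INR (S j))) in E
    by (try lra; apply Rle_ge, pos_INR).
  pose proof (INR_S_pos j) as Hj. pose proof (pow_lt _ p Hj) as Hjp.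
  assert (Hr : 2 * INR (S j) * Rabs (d (S j)) <= (Rabs k0 * K + K') / INR (S j) ^ p).
  { rewrite E. eapply Rle_trans; [apply Rabs_triang|]. rewrite Rabs_Ropp, Rabs_mult.
    unfold Rdiv. rewrite Rmult_plus_distr_r. apply Rplus_le_compat.
    - rewrite Rmult_assoc. apply Rmult_le_compat_l; [apply Rabs_pos | apply Hy].
    - eapply Rle_trans; [apply He|]. unfold Rdiv. apply Rmult_le_compat_l; [exact HK'|].
      apply Rinv_le_contravar; [exact Hjp|]. apply pow_incr.
      rewrite (S_INR (S j)). lra. }
  set (C := Rabs k0 * K + K') in *. pose proof (Rabs_pos (d (S j))).
  apply (Rmult_le_reg_l (INR (S j))); [exact Hj|].
  replace (INR (S j) * (C / INR (S j) ^ S p)) with (C / INR (S j) ^ p)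
    by (cbn [pow]; field; lra).
  nra.
Qed.

(** With y = z / (2 j), a difference of y splits into d / (2 j) and z / (2 j (j + 1)); boundedness
    of d makes z at most linear, so both are O(1/j). *)
Lemma y_diff_decay : poly_decay 1 ((fC 1 - fX) * y)%fps.
Proof.
  destruct delta_bounded as (M & HM & H0 & H).
  apply poly_decay_tail, poly_decay_tail. exists (M + M). intros j.
  rewrite sub_fX_mulE, pow_1.
  assert (E : y (S (S j)) - y (S j) =
    d (S (S j)) / (2 * INR (S (S j))) - z (S j) / (2 * INR (S j) * INR (S (S j)))).
  { unfold d. rewrite sub_fX_mulE, !z_coef, (S_INR (S j)).
    pose proof (INR_S_pos j). field. lra. }
  rewrite E. pose proof (z_linear M (S j) ltac:(intros; apply H)) as Hz.
  pose proof (INR_S_pos j) as Hj. rewrite (S_INR (S j)). set (x := INR (S j)) in *.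
  unfold Rminus. eapply Rle_trans; [apply Rabs_triang|]. rewrite Rabs_Ropp.
  unfold Rdiv. rewrite !Rabs_mult, !Rabs_inv, !Rabs_mult, (Rabs_right 2), (Rabs_right x),
    (Rabs_right (x + 1)) by lra.
  specialize (H (S (S j))). rewrite Rmult_plus_distr_r. apply Rplus_le_compat.
  - apply Rmult_le_compat; try apply Rabs_pos; [|exact H|].
    + apply Rlt_le, Rinv_0_lt_compat; lra.
    + apply Rinv_le_contravar; lra.
  - apply Rle_trans with (x * M * / (2 * x * (x + 1))).
    + apply Rmult_le_compat_r; [|exact Hz]. apply Rlt_le, Rinv_0_lt_compat; nra.
    + replace (x * M * / (2 * x * (x + 1))) with (M * / (2 * (x + 1))) by (field; lra).
      apply Rmult_le_compat_l; [exact HM|]. apply Rinv_le_contravar; nra.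
Qed.

Lemma delta_decay : poly_decay 2 d.
Proof.
  apply delta_step; [exact y_diff_decay|]. apply delta_step.
  - apply (poly_decay_weaken 1); [lia | exact y_diff_decay].
  - destruct delta_bounded as (M & HM & H0 & H). exists M. intros n.
    simpl. unfold Rdiv. rewrite Rinv_1, Rmult_1_r. apply H.
Qed.

(** The partial sums of d are 2 n y n, and they converge by [delta_decay]. *)
Lemma y_decay : poly_decay 1 y.
Proof.
  destruct (poly_decay_series d delta_decay) as (l & _ & Hl).
  destruct Hl as [K HK]. apply poly_decay_tail. exists (K + Rabs l). intros n.
  specialize (HK (S n)). rewrite <- z_sum_delta, z_coef in HK. rewrite pow_1 in *.
  pose proof (INR_S_pos n). pose proof (INR_S_pos (S n)).
  apply (Rmult_le_reg_l (INR (S n))); [assumption|].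
  replace (INR (S n) * ((K + Rabs l) / INR (S n))) with (K + Rabs l) by (field; lra).
  rewrite <- (Rabs_right (INR (S n))) at 1 by lra. rewrite <- Rabs_mult.
  assert (HKp : 0 <= K).
  { pose proof (Rabs_pos (2 * INR (S n) * y (S n) - l)).
    apply (Rmult_le_reg_r (/ INR (S (S n)))); [apply Rinv_0_lt_compat; assumption|].
    unfold Rdiv in HK. lra. }
  assert (HK1 : K / INR (S (S n)) <= K).
  { unfold Rdiv. rewrite <- (Rmult_1_r K) at 2. apply Rmult_le_compat_l; [exact HKp|].
    rewrite <- Rinv_1. apply Rinv_le_contravar; [lra|]. rewrite S_INR. lra. }
  assert (Ht : Rabs (2 * INR (S n) * y (S n)) <= K + Rabs l).
  { replace (2 * INR (S n) * y (S n)) with ((2 * INR (S n) * y (S n) - l) + l) by ring.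
    eapply Rle_trans; [apply Rabs_triang|]. lra. }
  rewrite Rmult_assoc, Rabs_mult, (Rabs_right 2) in Ht by lra.
  pose proof (Rabs_pos (INR (S n) * y (S n))). lra.
Qed.

End Bootstrap.

(** * The connection constant *)

(** Split at N: the head is controlled by 1 - u^n <= n (1 - u), and the rest by the tail of the
    absolute values. *)
Lemma abel_limit (a : fps) (l : R) : poly_decay 2 a -> is_series a l ->
  forall e, 0 < e -> exists dl, 0 < dl /\
    forall u, 0 <= u -> 1 - dl < u < 1 -> Rabs (PSeries a u - l) <= e.
Proof.
  intros Ha Hl e He.
  destruct (poly_decay_series (fun n => Rabs (a n))) as (l' & _ & Ht).
  { destruct Ha as [K H]. exists K. intros n. rewrite Rabs_Rabsolu. apply H. }
  apply poly_decay_nonneg in Ht. destruct Ht as (K & HK & Ht).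
  set (T := sum_f_R0 (fun n => Rabs (a n))) in *.
  (* From N on, the sums T lie within e/4 of their limit, so the tail beyond N is at most e/2. *)
  destruct (archimed_cor1 (e / (4 * (K + 1)))) as [N [HN HN0]].
  { apply Rdiv_lt_0_compat; lra. }
  assert (HTpos : forall n, 0 <= T n) by (intros n; apply cond_pos_sum; intros; apply Rabs_pos).
  assert (HTN : forall d, T (N + d)%nat - T N <= e / 2).
  { intros d. pose proof (Ht N) as H1. pose proof (Ht (N + d)%nat) as H2.
    rewrite pow_1 in *.
    assert (Hi : forall k, (N <= k)%nat -> K / INR (S k) <= e / 4).
    { intros k Hk. assert (/ INR (S k) <= / INR N)
        by (apply Rinv_le_contravar; [apply lt_0_INR; lia | apply le_INR; lia]).
      apply Rle_trans with (K * (e / (4 * (K + 1)))).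
      - unfold Rdiv at 1. apply Rmult_le_compat_l; lra.
      - replace (K * (e / (4 * (K + 1)))) with (e / 4 * (K / (K + 1))) by (field; lra).
        rewrite <- (Rmult_1_r (e / 4)) at 2. apply Rmult_le_compat_l; [lra|].
        apply (Rmult_le_reg_r (K + 1)); [lra|]. unfold Rdiv.
        rewrite Rmult_assoc, Rinv_l by lra. lra. }
    pose proof (Hi N (le_n _)). pose proof (Hi (N + d)%nat ltac:(lia)).
    apply Rabs_le_between in H1. apply Rabs_le_between in H2. lra. }
  assert (Hbern : forall u n, 0 <= u <= 1 -> 0 <= 1 - u ^ n <= INR n * (1 - u)).
  { intros u n Hu. assert (Hle : 0 <= u ^ n <= 1).
    { split; [apply pow_le; lra|]. rewrite <- (pow1 n). apply pow_incr; lra. }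
    split; [lra|]. clear Hle. induction n as [|n IH]; [simpl; lra|].
    rewrite S_INR. cbn [pow].
    assert (u ^ n <= 1) by (rewrite <- (pow1 n); apply pow_incr; lra).
    assert (0 <= u ^ n) by (apply pow_le; lra). nra. }
  (* Keeps the contribution of the first terms, N (1 - u) T N, below e/2. *)
  set (dl := e / 2 / (INR N * T N + 1)).
  assert (HNT : 0 <= INR N * T N) by (apply Rmult_le_pos; [apply pos_INR | apply HTpos]).
  exists dl. split; [apply Rdiv_lt_0_compat; lra|]. intros u Hu0 Hu.
  assert (Hpart : forall d, Rabs (sum_f_R0 (fun n => a n * u ^ n) (N + d) -
      sum_f_R0 a (N + d)) <= e).
  { intros d. rewrite <- minus_sum. eapply Rle_trans; [apply Rsum_abs|].
    apply Rle_trans with (INR N * (1 - u) * T N + (T (N + d)%nat - T N)).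
    - induction d as [|d IH].
      + rewrite Nat.add_0_r, Rminus_diag, Rplus_0_r. unfold T. rewrite <- sum_f_R0_scal.
        apply sum_Rle. intros n Hn.
        replace (a n * u ^ n - a n) with (- (a n * (1 - u ^ n))) by ring.
        rewrite Rabs_Ropp, Rabs_mult, Rmult_comm.
        apply Rmult_le_compat_r; [apply Rabs_pos|].
        destruct (Hbern u n) as [Hb1 Hb2]; [lra|]. rewrite Rabs_right by lra.
        eapply Rle_trans; [exact Hb2|]. apply Rmult_le_compat_r; [lra|].
        apply le_INR. exact Hn.
      + rewrite Nat.add_succ_r, tech5. unfold T at 2. rewrite tech5. fold T.
        destruct (Hbern u (S (N + d))) as [Hb1 Hb2]; [lra|].
        assert (0 <= u ^ S (N + d)) by (apply pow_le; lra).
        replace (a (S (N + d)) * u ^ S (N + d) - a (S (N + d))) with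
          (- (a (S (N + d)) * (1 - u ^ S (N + d)))) by ring.
        rewrite Rabs_Ropp, Rabs_mult, (Rabs_right (1 - _)) by lra.
        pose proof (Rabs_pos (a (S (N + d)))). nra.
    - specialize (HTN d).
      assert (INR N * (1 - u) * T N <= e / 2); [|lra].
      replace (INR N * (1 - u) * T N) with ((1 - u) * (INR N * T N)) by ring.
      apply Rle_trans with (dl * (INR N * T N + 1)).
      + apply Rmult_le_compat; lra.
      + unfold dl. right. field. lra. }
  assert (Hps : is_series (fun n => a n * u ^ n) (PSeries a u)).
  { apply Series_correct. apply ex_series_Rabs.
    apply (ex_series_le (fun n => Rabs (a n * u ^ n)) (fun n => Rabs (a n))).
    - intros n. unfold norm; simpl. unfold abs; simpl. rewrite Rabs_Rabsolu, Rabs_mult.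
      rewrite <- (Rmult_1_r (Rabs (a n))) at 2. apply Rmult_le_compat_l; [apply Rabs_pos|].
      destruct (Hbern u n) as [Hb1 _]; [lra|]. rewrite Rabs_right; [lra|].
      apply Rle_ge, pow_le, Hu0.
    - apply poly_decay_ex_abs, Ha. }
  apply is_series_Reals, is_lim_seq_Reals in Hps. apply is_series_Reals, is_lim_seq_Reals in Hl.
  pose proof (is_lim_seq_minus' _ _ _ _ Hps Hl) as Hm.
  apply (is_lim_seq_incr_n _ N) in Hm. apply is_lim_seq_abs in Hm.
  apply (is_lim_seq_le _ (fun _ => e) (Rabs (PSeries a u - l)) e) in Hm;
    [exact Hm| |apply is_lim_seq_const].
  intros d. rewrite Nat.add_comm. apply Hpart.
Qed.

Lemma CV_radius_bounded_coef (a : fps) (x : R) :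
  poly_decay 0 a -> Rabs x < 1 -> Rbar_lt (Rabs x) (CV_radius a).
Proof.
  intros [M H] Hx. apply (Rbar_lt_le_trans (Rabs x) 1); [exact Hx|].
  apply (CV_radius_bounded a). exists M. intros n. rewrite pow1, Rmult_1_r.
  specialize (H n). simpl in H. unfold Rdiv in H. rewrite Rinv_1, Rmult_1_r in H. exact H.
Qed.

Lemma PSeries_theta (a : fps) (x : R) :
  PSeries (theta a) x = x * PSeries (PS_derive a) x.
Proof.
  rewrite <- PSeries_incr_1. apply PSeries_ext. intros [|n]; unfold theta, PS_incr_1, PS_derive.
  - simpl. unfold zero; simpl. ring.
  - reflexivity.
Qed.

Lemma is_derive_PSeries_comp (a : fps) (g : R -> R) (x dg : R) :
  poly_decay 0 a -> 0 < g x < 1 -> is_derive g x dg ->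
  is_derive (fun x => PSeries a (g x)) x (dg * (PSeries (theta a) (g x) / g x)).
Proof.
  intros Ha Hg Hd. rewrite PSeries_theta.
  replace (dg * _) with (scal dg (PSeries (PS_derive a) (g x)))
    by (unfold scal; simpl; unfold mult; simpl; field; lra).
  apply (is_derive_comp (PSeries a) g); [|exact Hd].
  apply is_derive_PSeries, CV_radius_bounded_coef; [exact Ha|]. rewrite Rabs_right; lra.
Qed.

Lemma continuity_pt_PSeries_comp (a : fps) (g : R -> R) (x : R) :
  poly_decay 0 a -> 0 <= g x < 1 -> continuity_pt g x ->
  continuity_pt (fun x => PSeries a (g x)) x.
Proof.
  intros Ha Hg Hc. apply (continuity_pt_comp g (PSeries a)); [exact Hc|].
  apply derivable_continuous_pt, ex_derive_Reals_0. eexists.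
  apply is_derive_PSeries, CV_radius_bounded_coef; [exact Ha|]. rewrite Rabs_right; lra.
Qed.

Lemma PSeries_fmul (a b : fps) (x : R) : poly_decay 0 a -> poly_decay 0 b -> Rabs x < 1 ->
  PSeries (a * b)%fps x = PSeries a x * PSeries b x.
Proof.
  intros Ha Hb Hx. apply PSeries_mult; apply CV_radius_bounded_coef; assumption.
Qed.

Lemma PSeries_fX (a : fps) (x : R) : PSeries (fX * a)%fps x = x * PSeries a x.
Proof.
  rewrite <- PSeries_incr_1. apply PSeries_ext. intros [|n].
  - rewrite fX_mulE0. reflexivity.
  - rewrite fX_mulE. reflexivity.
Qed.

Lemma PSeries_fC (c : R) (a : fps) (x : R) : PSeries (fC c * a)%fps x = c * PSeries a x.
Proof.
  rewrite <- PSeries_scal. apply PSeries_ext. intros n. rewrite fC_mulE. reflexivity.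
Qed.

Lemma geo_decay_fX : geo_decay fX.
Proof.
  exists 2, (/ 2). split; [lra|]. split; [lra|]. intros n.
  assert (0 < (/ 2) ^ n) by (apply pow_lt; lra).
  destruct n as [|[|n]]; unfold fX; rewrite ?Rabs_R0, ?Rabs_R1; simpl in *; lra.
Qed.

Lemma geo_decay_cosH : geo_decay cosH.
Proof.
  exists 5.26, (/ 4). split; [lra|]. split; [lra|]. intros [|n].
  - rewrite cosH_0, Rabs_R1. simpl. lra.
  - eapply Rle_trans; [apply cosH_geometric|]. simpl.
    assert (0 < (/ 4) ^ n) by (apply pow_lt; lra). lra.
Qed.

Lemma PSeries_sub_fX (a : fps) (x : R) : poly_decay 0 a -> Rabs x < 1 ->
  PSeries ((fC 1 - fX) * a)%fps x = (1 - x) * PSeries a x.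
Proof.
  intros Ha Hx. transitivity (PSeries (PS_minus a (fX * a)%fps) x).
  - apply PSeries_ext. intros n. replace ((fC 1 - fX) * a)%fps with (a - fX * a)%fps by ring.
    reflexivity.
  - rewrite PSeries_minus, PSeries_fX; [ring| |];
      apply CV_radius_inside, CV_radius_bounded_coef; try assumption.
    apply poly_decay_conv; [exact geo_decay_fX | exact Ha].
Qed.

Lemma PSeries_cosH (x : R) : PSeries cosH (x ^ 2) = cos (PI / 2 * x).
Proof.
  rewrite <- (is_series_unique _ _ (is_series_cos (PI / 2 * x))).
  apply Series_ext. intros n. unfold cosH.
  replace (- (PI / 2 * x) ^ 2) with (- (PI / 2) ^ 2 * x ^ 2) by ring.
  rewrite (Rpow_mult_distr _ (x ^ 2)). unfold Rdiv. ring.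
Qed.

Lemma PSeries_sincH (x : R) : PI / 2 * x * PSeries sincH (x ^ 2) = sin (PI / 2 * x).
Proof.
  rewrite <- (is_series_unique _ _ (is_series_sin (PI / 2 * x))), Series_scal_l.
  f_equal. apply Series_ext. intros n. unfold sincH.
  replace (- (PI / 2 * x) ^ 2) with (- (PI / 2) ^ 2 * x ^ 2) by ring.
  rewrite (Rpow_mult_distr _ (x ^ 2)). unfold Rdiv. ring.
Qed.

(** Differentiability is asked only in the interior, since the system below is singular at x = 0. *)
Lemma zero_derivative_eq (f : R -> R) (b : R) : 0 < b ->
  (forall x, 0 < x < b -> is_derive f x 0) ->
  (forall x, 0 <= x <= b -> continuity_pt f x) -> f b = f 0.
Proof.
  intros Hb Hd Hc. destruct (MVT_gen f 0 b (fun _ => 0)) as [c [_ E]].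
  - intros x Hx. rewrite Rmin_left, Rmax_right in Hx by lra. apply Hd, Hx.
  - intros x Hx. rewrite Rmin_left, Rmax_right in Hx by lra. apply Hc, Hx.
  - lra.
Qed.

(* Coefficients of the hypergeometric series [2F1 (1/2, 1/2; 1; z)]. *)
Definition hyp : fps := fun n => odd_even_ratio n ^ 2.
(** The flux of the hypergeometric equation, the counterpart of [u] below when z = sin (PI x /
    2)^2. *)
Definition hyp_delta : fps := ((fC 1 - fX) * theta hyp)%fps.

Lemma hyp_S (n : nat) : INR (S n) ^ 2 * hyp (S n) = (INR n + / 2) ^ 2 * hyp n.
Proof.
  unfold hyp. cbn [odd_even_ratio].
  rewrite !plus_INR, !mult_INR, S_INR. pose proof (pos_INR n).
  replace (INR 2) with 2 by reflexivity. replace (INR 1) with 1 by reflexivity.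
  field. lra.
Qed.

Lemma hyp_pos (n : nat) : 0 <= hyp n.
Proof. apply pow2_ge_0. Qed.

Lemma hyp_le (n : nat) : hyp n <= / INR (S n).
Proof.
  (* This stronger bound propagates because (2 n + 3) (2 n + 1) / 4 < (n + 1)^2. *)
  assert (H : (2 * INR n + 1) * hyp n <= 1).
  { induction n as [|n IH]; [unfold hyp; simpl; lra|].
    pose proof (hyp_S n) as E. rewrite S_INR in *. pose proof (pos_INR n).
    pose proof (hyp_pos n). pose proof (hyp_pos (S n)).
    apply (Rmult_le_reg_l ((INR n + 1) ^ 2)); [nra|].
    replace ((INR n + 1) ^ 2 * ((2 * (INR n + 1) + 1) * hyp (S n))) with
      ((2 * (INR n + 1) + 1) * ((INR n + 1) ^ 2 * hyp (S n))) by ring.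
    rewrite E.
    replace ((2 * (INR n + 1) + 1) * ((INR n + / 2) ^ 2 * hyp n)) with
      ((2 * INR n + 3) * (INR n + / 2) / 2 * ((2 * INR n + 1) * hyp n)) by field.
    apply Rle_trans with ((2 * INR n + 3) * (INR n + / 2) / 2 * 1).
    - apply Rmult_le_compat_l; [nra | exact IH].
    - nra. }
  pose proof (INR_S_pos n). apply (Rmult_le_reg_l (INR (S n))); [assumption|].
  rewrite Rinv_r by lra. rewrite S_INR in *. pose proof (hyp_pos n). pose proof (pos_INR n).
  nra.
Qed.

Lemma poly_decay_hyp : poly_decay 1 hyp.
Proof.
  exists 1. intros n. rewrite Rabs_right by (apply Rle_ge, hyp_pos).
  rewrite pow_1. unfold Rdiv. rewrite Rmult_1_l. apply hyp_le.
Qed.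

(** The leading terms cancel in (n + 1/2)^2 - n (n + 1) = 1/4, which is why [hyp_delta] is
    O(1/n^2). *)
Lemma hyp_delta_S (n : nat) : INR (S n) * hyp_delta (S n) = hyp n / 4.
Proof.
  unfold hyp_delta. rewrite sub_fX_mulE. unfold theta.
  pose proof (hyp_S n) as E. rewrite S_INR in *.
  transitivity ((INR n + 1) ^ 2 * hyp (S n) - (INR n + 1) * INR n * hyp n); [ring|].
  rewrite E. field.
Qed.

Lemma theta_hyp_delta : theta hyp_delta = (fC (/ 4) * (fX * hyp))%fps.
Proof.
  extensionality n. rewrite fC_mulE. unfold theta. destruct n as [|n].
  - rewrite fX_mulE0. simpl. ring.
  - rewrite hyp_delta_S, fX_mulE. field.
Qed.

Lemma poly_decay_hyp_delta : poly_decay 2 hyp_delta.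
Proof.
  apply poly_decay_tail. exists 1. intros n. pose proof (INR_S_pos n).
  pose proof (hyp_le n). pose proof (hyp_pos n).
  replace (hyp_delta (S n)) with (/ INR (S n) * (hyp n / 4)).
  - rewrite Rabs_right.
    + cbn [pow]. rewrite Rmult_1_r. unfold Rdiv. rewrite Rmult_1_l, Rinv_mult.
      apply Rmult_le_compat_l; [apply Rlt_le, Rinv_0_lt_compat; assumption | lra].
    + apply Rle_ge, Rmult_le_pos; [apply Rlt_le, Rinv_0_lt_compat; assumption | lra].
  - rewrite <- hyp_delta_S. field. lra.
Qed.

Lemma sum_hyp_delta (n : nat) : sum_f_R0 hyp_delta n = theta hyp n.
Proof.
  induction n as [|n IH].
  - unfold hyp_delta. cbn [sum_f_R0]. rewrite sub_fX_mulE0. reflexivity.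
  - rewrite tech5, IH. unfold hyp_delta. rewrite sub_fX_mulE. ring.
Qed.

Lemma is_series_hyp_delta : is_lim_seq (fun n => INR n * odd_even_ratio n ^ 2) (/ PI) ->
  is_series hyp_delta (/ PI).
Proof.
  intros H. apply is_series_Reals, is_lim_seq_Reals.
  revert H. apply is_lim_seq_ext. intros n. rewrite sum_hyp_delta. reflexivity.
Qed.

Lemma poly_decay_theta_hyp : poly_decay 0 (theta hyp).
Proof. exact (poly_decay_theta _ poly_decay_hyp). Qed.

Lemma hyp_PSeries_ge (x : R) : 0 <= x < 1 -> 1 <= PSeries hyp x.
Proof.
  intros Hx.
  assert (Hps : is_series (fun n => hyp n * x ^ n) (PSeries hyp x)).
  { apply Series_correct.
    apply (ex_series_ext (fun n => scal (pow_n x n) (hyp n))).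
    - intros n. rewrite pow_n_pow. unfold scal; simpl; unfold mult; simpl. ring.
    - apply CV_radius_inside, CV_radius_bounded_coef.
      + apply (poly_decay_weaken 1); [lia | exact poly_decay_hyp].
      + rewrite Rabs_right; lra. }
  apply is_series_Reals, is_lim_seq_Reals in Hps.
  apply (is_lim_seq_le (fun _ => 1) _ 1 (PSeries hyp x)) in Hps;
    [exact Hps| |apply is_lim_seq_const].
  intros n. induction n as [|n IH].
  - unfold hyp. simpl. lra.
  - rewrite tech5. assert (0 <= hyp (S n) * x ^ S n).
    { apply Rmult_le_pos; [apply hyp_pos | apply pow_le; lra]. }
    lra.
Qed.

Lemma sin_cos_pos (x : R) : 0 < x < 1 -> 0 < sin (PI / 2 * x) /\ 0 < cos (PI / 2 * x).
Proof.
  intros Hx. pose proof PI_RGT_0. split.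
  - apply sin_gt_0; nra.
  - apply cos_gt_0; nra.
Qed.

Lemma sin_sq_lt1 (x : R) : 0 < x < 1 -> 0 < sin (PI / 2 * x) ^ 2 < 1.
Proof.
  intros Hx. destruct (sin_cos_pos x Hx) as [Hs Hc].
  pose proof (sin2_cos2 (PI / 2 * x)) as E. unfold Rsqr in E. split; nra.
Qed.

Lemma poly_decay_0_of (p : nat) (f : fps) : poly_decay p f -> poly_decay 0 f.
Proof. apply poly_decay_weaken. lia. Qed.

(** * Identification of y with the hypergeometric function and the limit at x = 1 *)

Section Connection.

Variable y : fps.
Hypothesis y_0 : y 0%nat = 1.
Hypothesis y_ode :
  (fC 4 * theta (sincH * cosH * theta y) =
   fC (PI ^ 2 / 4) * (fX * (sincH * cosH * y)))%fps.
Hypothesis hyp_limit : is_lim_seq (fun n => INR n * odd_even_ratio n ^ 2) (/ PI).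

Let d : fps := ((fC 1 - fX) * (fC 2 * theta y))%fps.
(** At s = x^2 this is sin (PI x / 2) cos (PI x / 2) y'(x) / PI; unlike [theta y], it has a finite
    value at s = 1. *)
Let u : fps := (sincH * cosH * theta y)%fps.

Lemma legendre_delta_decay : poly_decay 2 d.
Proof.
  exact (delta_decay y kernelQ_log (PI ^ 2 / 4) geo_decay_kernelQ_log kernelQ_log_0
           (legendre_delta y _ y_ode)).
Qed.

Lemma legendre_decay : poly_decay 1 y.
Proof.
  exact (y_decay y kernelQ_log (PI ^ 2 / 4) geo_decay_kernelQ_log kernelQ_log_0
           (legendre_delta y _ y_ode)).
Qed.

Lemma legendre_u : u = (fC (/ 2) * (kernelQ * d))%fps.
Proof.
  unfold u, d. rewrite sincH_cosH_kernelQ.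
  transitivity ((fC (/ 2) * fC 2) * ((fC 1 - fX) * kernelQ * theta y))%fps; [|ring].
  rewrite fC_mul. replace (/ 2 * 2) with 1 by field. ring.
Qed.

Lemma legendre_u_decay : poly_decay 2 u.
Proof.
  rewrite legendre_u.
  apply poly_decay_scal, poly_decay_conv; [exact geo_decay_kernelQ | exact legendre_delta_decay].
Qed.

Lemma theta_legendre_u : theta u = (fC (PI ^ 2 / 16) * (fX * (sincH * cosH * y)))%fps.
Proof.
  transitivity (fC (/ 4) * (fC 4 * theta u))%fps.
  - rewrite fmulA, fC_mul. replace (/ 4 * 4) with 1 by field. ring.
  - unfold u. rewrite y_ode, fmulA, fC_mul. f_equal. f_equal. field.
Qed.

Lemma geo_decay_sincH_cosH : geo_decay (sincH * cosH)%fps.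
Proof. apply geo_decay_mul; [exact geo_decay_sincH | exact geo_decay_cosH]. Qed.

Let yf (x : R) := PSeries y (x ^ 2).
Let uf (x : R) := PSeries u (x ^ 2).
Let hf (x : R) := PSeries hyp (sin (PI / 2 * x) ^ 2).
Let wf (x : R) := PSeries hyp_delta (sin (PI / 2 * x) ^ 2).
Let sc (x : R) := sin (PI / 2 * x) * cos (PI / 2 * x).

Lemma PSeries_sincH_cosH (x : R) : 0 < x < 1 ->
  PI / 2 * x * PSeries (sincH * cosH)%fps (x ^ 2) = sc x.
Proof.
  intros Hx. assert (Hx2 : Rabs (x ^ 2) < 1) by (rewrite Rabs_right; nra).
  rewrite PSeries_fmul.
  - rewrite PSeries_cosH. unfold sc. rewrite <- PSeries_sincH. ring.
  - apply geo_poly_decay, geo_decay_sincH.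
  - apply geo_poly_decay, geo_decay_cosH.
  - exact Hx2.
Qed.

Lemma poly_decay_theta_legendre : poly_decay 0 (theta y).
Proof. exact (poly_decay_theta _ legendre_decay). Qed.

Lemma is_derive_sq (x : R) : is_derive (fun x => x ^ 2) x (2 * x).
Proof. auto_derive; [trivial|]. ring. Qed.

Lemma is_derive_sin_sq (x : R) :
  is_derive (fun x => sin (PI / 2 * x) ^ 2) x (PI * sc x).
Proof. auto_derive; [trivial|]. unfold sc. field. Qed.

(** This and the next three lemmas show that (yf, uf) and (hf, wf) solve one system: f' = PI g / sc,
    g' = PI sc f / 4. *)
Lemma is_derive_yf (x : R) : 0 < x < 1 -> is_derive yf x (PI * uf x / sc x).
Proof.
  intros Hx. evar_last.
  - apply (is_derive_PSeries_comp y (fun x => x ^ 2)); [| |apply is_derive_sq].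
    + exact (poly_decay_0_of _ _ legendre_decay).
    + nra.
  - pose proof (PSeries_sincH_cosH x Hx) as E. destruct (sin_cos_pos x Hx).
    assert (0 < sc x) by (apply Rmult_lt_0_compat; assumption). pose proof PI_RGT_0.
    unfold uf, u. rewrite PSeries_fmul.
    + set (q := PSeries (sincH * cosH)%fps (x ^ 2)) in *.
      rewrite <- E in *. assert (q <> 0) by (intros Hq; rewrite Hq in *; lra).
      field. repeat split; lra.
    + apply geo_poly_decay, geo_decay_sincH_cosH.
    + exact poly_decay_theta_legendre.
    + rewrite Rabs_right; nra.
Qed.

Lemma is_derive_uf (x : R) : 0 < x < 1 -> is_derive uf x (PI / 4 * sc x * yf x).
Proof.
  intros Hx. evar_last.
  - apply (is_derive_PSeries_comp u (fun x => x ^ 2)); [| |apply is_derive_sq].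
    + exact (poly_decay_0_of _ _ legendre_u_decay).
    + nra.
  - rewrite theta_legendre_u, PSeries_fC, PSeries_fX, PSeries_fmul.
    + rewrite <- (PSeries_sincH_cosH x Hx). unfold yf. field. lra.
    + apply geo_poly_decay, geo_decay_sincH_cosH.
    + exact (poly_decay_0_of _ _ legendre_decay).
    + rewrite Rabs_right; nra.
Qed.

Lemma is_derive_hf (x : R) : 0 < x < 1 -> is_derive hf x (PI * wf x / sc x).
Proof.
  intros Hx. pose proof (sin_sq_lt1 x Hx) as Hs. destruct (sin_cos_pos x Hx). evar_last.
  - apply (is_derive_PSeries_comp hyp (fun x => sin (PI / 2 * x) ^ 2));
      [|exact Hs|apply is_derive_sin_sq].
    exact (poly_decay_0_of _ _ poly_decay_hyp).
  - unfold wf, hyp_delta. rewrite PSeries_sub_fX.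
    + replace (1 - sin (PI / 2 * x) ^ 2) with (cos (PI / 2 * x) ^ 2).
      * unfold sc. field. split; lra.
      * pose proof (sin2_cos2 (PI / 2 * x)) as E. unfold Rsqr in E. nra.
    + exact poly_decay_theta_hyp.
    + rewrite Rabs_right; lra.
Qed.

Lemma is_derive_wf (x : R) : 0 < x < 1 -> is_derive wf x (PI / 4 * sc x * hf x).
Proof.
  intros Hx. pose proof (sin_sq_lt1 x Hx) as Hs. destruct (sin_cos_pos x Hx). evar_last.
  - apply (is_derive_PSeries_comp hyp_delta (fun x => sin (PI / 2 * x) ^ 2));
      [|exact Hs|apply is_derive_sin_sq].
    exact (poly_decay_0_of _ _ poly_decay_hyp_delta).
  - rewrite theta_hyp_delta, PSeries_fC, PSeries_fX. unfold hf. field. lra.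
Qed.

Lemma continuity_pt_sq_comp (a : fps) (x : R) : poly_decay 0 a -> 0 <= x < 1 ->
  continuity_pt (fun x => PSeries a (x ^ 2)) x.
Proof.
  intros Ha Hx. apply (continuity_pt_PSeries_comp a (fun x => x ^ 2)); [exact Ha|nra|].
  apply derivable_continuous_pt, ex_derive_Reals_0. eexists. apply is_derive_sq.
Qed.

Lemma continuity_pt_sin_sq_comp (a : fps) (x : R) : poly_decay 0 a -> 0 <= x < 1 ->
  continuity_pt (fun x => PSeries a (sin (PI / 2 * x) ^ 2)) x.
Proof.
  intros Ha Hx. apply (continuity_pt_PSeries_comp a (fun x => sin (PI / 2 * x) ^ 2)).
  - exact Ha.
  - destruct (Req_dec x 0) as [->|Hne].
    + rewrite Rmult_0_r, sin_0. lra.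
    + pose proof (sin_sq_lt1 x ltac:(lra)). lra.
  - apply derivable_continuous_pt, ex_derive_Reals_0. eexists. apply is_derive_sin_sq.
Qed.

Lemma hf_ge1 (x : R) : 0 <= x < 1 -> 1 <= hf x.
Proof.
  intros Hx. apply hyp_PSeries_ge. destruct (Req_dec x 0) as [->|Hne].
  - rewrite Rmult_0_r, sin_0. lra.
  - pose proof (sin_sq_lt1 x ltac:(lra)). lra.
Qed.

Lemma values_at0 : yf 0 = 1 /\ uf 0 = 0 /\ hf 0 = 1 /\ wf 0 = 0.
Proof.
  unfold yf, uf, hf, wf. rewrite Rmult_0_r, sin_0.
  replace (0 ^ 2) with 0 by ring. rewrite !PSeries_0. repeat split.
  - exact y_0.
  - unfold u. rewrite fmul_0. unfold theta. simpl. ring.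
  - unfold hyp. simpl. ring.
  - unfold hyp_delta. rewrite sub_fX_mulE0. unfold theta. simpl. ring.
Qed.

Lemma continuity_all (x : R) : 0 <= x < 1 ->
  continuity_pt yf x /\ continuity_pt uf x /\ continuity_pt hf x /\ continuity_pt wf x.
Proof.
  intros Hx. repeat split.
  - apply continuity_pt_sq_comp; [exact (poly_decay_0_of _ _ legendre_decay) | exact Hx].
  - apply continuity_pt_sq_comp; [exact (poly_decay_0_of _ _ legendre_u_decay) | exact Hx].
  - apply continuity_pt_sin_sq_comp; [exact (poly_decay_0_of _ _ poly_decay_hyp) | exact Hx].
  - apply continuity_pt_sin_sq_comp; [exact (poly_decay_0_of _ _ poly_decay_hyp_delta) | exact Hx].
Qed.

(** The Wronskian of two solutions of the system is constant, and it vanishes at 0 because both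
    fluxes do. *)
Lemma wronskian_zero (b : R) : 0 < b < 1 -> yf b * wf b - hf b * uf b = 0.
Proof.
  intros Hb. destruct values_at0 as (Y0 & U0 & H0 & W0).
  transitivity (yf 0 * wf 0 - hf 0 * uf 0); [|rewrite Y0, U0, H0, W0; ring].
  apply (zero_derivative_eq (fun x => yf x * wf x - hf x * uf x)); [lra| |].
  - intros x Hx. assert (Hx1 : 0 < x < 1) by lra.
    pose proof (is_derive_yf x Hx1) as D1. pose proof (is_derive_uf x Hx1) as D2.
    pose proof (is_derive_hf x Hx1) as D3. pose proof (is_derive_wf x Hx1) as D4.
    apply is_derive_Reals in D1, D2, D3, D4. apply is_derive_Reals.
    pose proof (derivable_pt_lim_minus _ _ _ _ _ (derivable_pt_lim_mult _ _ _ _ _ D1 D4)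
                  (derivable_pt_lim_mult _ _ _ _ _ D3 D2)) as D.
    match type of D with derivable_pt_lim _ _ ?l => replace l with 0 in D end; [exact D|].
    unfold Rdiv. ring.
  - intros x Hx. destruct (continuity_all x) as (C1 & C2 & C3 & C4); [lra|].
    apply (continuity_pt_minus (fun x => yf x * wf x) (fun x => hf x * uf x)).
    + exact (continuity_pt_mult yf wf x C1 C4).
    + exact (continuity_pt_mult hf uf x C3 C2).
Qed.

(** Replaces uniqueness at the singular point 0: the derivative of yf / hf is a multiple of the
    Wronskian, and hf >= 1 allows the division. *)
Lemma yf_hf (b : R) : 0 < b < 1 -> yf b = hf b.
Proof.
  intros Hb. destruct values_at0 as (Y0 & _ & H0 & _).
  pose proof (hf_ge1 b ltac:(lra)).
  assert (E : yf b / hf b = yf 0 / hf 0).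
  { apply (zero_derivative_eq (fun x => yf x / hf x)); [lra| |].
    - intros x Hx. assert (Hx1 : 0 < x < 1) by lra.
      pose proof (is_derive_yf x Hx1) as D1. pose proof (is_derive_hf x Hx1) as D3.
      pose proof (hf_ge1 x ltac:(lra)). pose proof (wronskian_zero x Hx1) as W.
      apply is_derive_Reals in D1, D3. apply is_derive_Reals.
      pose proof (derivable_pt_lim_div _ _ _ _ _ D1 D3 ltac:(lra)) as D.
      match type of D with derivable_pt_lim _ _ ?l => replace l with 0 in D end; [exact D|].
      unfold Rdiv.
      replace (PI * uf x * / sc x * hf x - PI * wf x * / sc x * yf x) with
        (- (PI * / sc x) * (yf x * wf x - hf x * uf x)) by ring.
      rewrite W. ring.
    - intros x Hx. destruct (continuity_all x) as (C1 & C2 & C3 & C4); [lra|].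
      pose proof (hf_ge1 x ltac:(lra)).
      exact (continuity_pt_div yf hf x C1 C3 ltac:(lra)). }
  rewrite Y0, H0 in E. apply (Rmult_eq_reg_r (/ hf b)).
  - change (yf b / hf b = hf b / hf b). rewrite E. field. lra.
  - apply Rinv_neq_0_compat. lra.
Qed.

Lemma uf_wf (b : R) : 0 < b < 1 -> uf b = wf b.
Proof.
  intros Hb. pose proof (hf_ge1 b ltac:(lra)). pose proof (wronskian_zero b Hb) as W.
  rewrite yf_hf in W by exact Hb. apply (Rmult_eq_reg_l (hf b)); lra.
Qed.

(** As x tends to 1, the common flux tends to l / 4 by [legendre_u] and the value 1/2 of [kernelQ],
    and to 1 / PI by the hypergeometric side. *)
Lemma is_series_legendre_delta : is_series d (4 / PI).
Proof.
  pose proof PI_RGT_0 as Hpi.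
  destruct (poly_decay_series d legendre_delta_decay) as (l & Hl & _).
  assert (Hu : is_series u (l / 4)).
  { assert (Hk : is_series kernelQ (/ 2)).
    { replace (/ 2) with (2 / PI * (PI / 4)) by (field; lra).
      apply is_series_fmul; [exact is_series_sincH | exact is_series_cosQ
        | apply geo_decay_ex_abs, geo_decay_sincH | apply geo_decay_ex_abs, geo_decay_cosQ]. }
    rewrite legendre_u.
    apply (is_series_ext (fun n => / 2 * (kernelQ * d)%fps n)).
    - intros n. rewrite fC_mulE. reflexivity.
    - replace (l / 4) with (/ 2 * (/ 2 * l)) by field.
      apply (is_series_scal_l (/ 2) (kernelQ * d)%fps).
      apply is_series_fmul; [exact Hk | exact Hl | apply geo_decay_ex_abs, geo_decay_kernelQ
        | apply poly_decay_ex_abs, legendre_delta_decay]. }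
  pose proof (is_series_hyp_delta hyp_limit) as Hw.
  assert (E : l / 4 = / PI).
  { apply Rminus_diag_uniq. destruct (Req_dec (l / 4 - / PI) 0) as [E|E]; [exact E|exfalso].
    (* Two approximations within e cannot bridge a gap of 3 e. *)
    set (e := Rabs (l / 4 - / PI) / 3).
    assert (He : 0 < e) by (unfold e; pose proof (Rabs_pos_lt _ E); lra).
    destruct (abel_limit u _ legendre_u_decay Hu e He) as (d1 & Hd1 & A1).
    destruct (abel_limit hyp_delta _ poly_decay_hyp_delta Hw e He) as (d2 & Hd2 & A2).
    assert (Hc : continuity_pt (fun x => sin (PI / 2 * x) ^ 2) 1).
    { apply derivable_continuous_pt, ex_derive_Reals_0. eexists. apply is_derive_sin_sq. }
    destruct (Hc d2 Hd2) as (al & Hal & Hc2).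
    (* 1 - m is a point in (0, 1) where both Abel estimates hold: (1 - m)^2 > 1 - d1, and continuity
       of sin^2 at 1 handles d2. *)
    set (m := Rmin (/ 2) (Rmin (d1 / 4) (al / 2))).
    assert (Hm : 0 < m) by (unfold m; repeat apply Rmin_pos; lra).
    assert (Hm1 : m <= / 2) by apply Rmin_l.
    assert (Hm2 : m <= d1 / 4) by (eapply Rle_trans; [apply Rmin_r | apply Rmin_l]).
    assert (Hm3 : m <= al / 2) by (eapply Rle_trans; [apply Rmin_r | apply Rmin_r]).
    assert (Hx : 0 < 1 - m < 1) by lra.
    pose proof (sin_sq_lt1 _ Hx) as Hs.
    specialize (A1 ((1 - m) ^ 2) ltac:(nra) ltac:(nra)).
    assert (Hs2 : 1 - d2 < sin (PI / 2 * (1 - m)) ^ 2).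
    { assert (Hr : R_dist (sin (PI / 2 * (1 - m)) ^ 2) (sin (PI / 2 * 1) ^ 2) < d2).
      { apply Hc2. split.
        - split; [exact I | lra].
        - simpl. unfold R_dist. rewrite Rabs_left; lra. }
      rewrite Rmult_1_r, sin_PI2 in Hr. unfold R_dist in Hr.
      replace (1 ^ 2) with 1 in Hr by ring. rewrite Rabs_left in Hr; lra. }
    specialize (A2 (sin (PI / 2 * (1 - m)) ^ 2) ltac:(lra) ltac:(lra)).
    pose proof (uf_wf (1 - m) Hx) as Euw. unfold uf, wf in Euw. rewrite Euw in A1.
    assert (Rabs (l / 4 - / PI) <= e + e).
    { replace (l / 4 - / PI) with
        (- (PSeries hyp_delta (sin (PI / 2 * (1 - m)) ^ 2) - l / 4) +
         (PSeries hyp_delta (sin (PI / 2 * (1 - m)) ^ 2) - / PI)) by ring.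
      eapply Rle_trans; [apply Rabs_triang|]. rewrite Rabs_Ropp. lra. }
    unfold e in *. lra. }
  assert (E' : l = 4 / PI).
  { apply (Rmult_eq_reg_r (/ 4)); [|lra]. transitivity (/ PI); [exact E|]. field. lra. }
  rewrite <- E'. exact Hl.
Qed.

End Connection.

(** * Asymptotics of the coefficients *)

Lemma poly_decay_ext (p : nat) (f g : fps) :
  (forall n, f n = g n) -> poly_decay p f -> poly_decay p g.
Proof. intros E [K H]. exists K. intros n. rewrite <- E. apply H. Qed.

Section Asymptotics.

Variable y : fps.
Hypothesis y_0 : y 0%nat = 1.
Hypothesis y_ode :
  (fC 4 * theta (sincH * cosH * theta y) =
   fC (PI ^ 2 / 4) * (fX * (sincH * cosH * y)))%fps.
Hypothesis hyp_limit : is_lim_seq (fun n => INR n * odd_even_ratio n ^ 2) (/ PI).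

(** Expand 2 theta (y g) by the product rule. As 2 theta y is the constant sequence 4 / PI plus
    O(1/n), its main part times g gives partial sums of g, which converge geometrically; the rest is
    O(1/n) by convolution. *)
Lemma product_coef (g : fps) (l : R) : geo_decay g -> is_series g l ->
  poly_decay 1 (fun n => 2 * INR n * (y * g)%fps n - 4 / PI * l).
Proof.
  intros Hg Hl. set (d := ((fC 1 - fX) * (fC 2 * theta y))%fps).
  destruct (poly_decay_series d (legendre_delta_decay y y_ode)) as (l1 & Hl1 & Hd).
  destruct (geo_decay_series g Hg) as (l2 & Hl2 & Hgs).
  pose proof (is_series_legendre_delta y y_0 y_ode hyp_limit) as Hl1'. fold d in Hl1'.
  apply is_series_unique in Hl1, Hl1', Hl, Hl2.
  assert (E1 : l1 = 4 / PI) by (transitivity (Series d); [symmetry; exact Hl1 | exact Hl1']).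
  assert (E2 : l2 = l) by (transitivity (Series g); [symmetry; exact Hl2 | exact Hl]).
  rewrite E1 in Hd.
  set (zeta := fun n => sum_f_R0 d n - 4 / PI) in *.
  assert (Ez : (fC 2 * theta y)%fps = (fC (4 / PI) * ones + zeta)%fps).
  { extensionality n. unfold fadd. rewrite (fC_mulE (4 / PI)). unfold zeta, d.
    rewrite <- z_sum_delta. unfold ones. ring. }
  rewrite E2 in Hgs. set (gam := fun n => sum_f_R0 g n - l) in *.
  assert (E : forall n, (fC (4 / PI) * gam + (g * zeta + fC 2 * (theta g * y)))%fps n =
    2 * INR n * (y * g)%fps n - 4 / PI * l).
  { intros n. transitivity ((fC 2 * theta (y * g))%fps n - 4 / PI * l).
    - rewrite theta_mul.
      replace (fC 2 * (theta y * g + y * theta g))%fps with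
        ((fC 2 * theta y) * g + fC 2 * (theta g * y))%fps by ring.
      rewrite Ez.
      replace ((fC (4 / PI) * ones + zeta) * g)%fps with
        (fC (4 / PI) * (g * ones) + g * zeta)%fps by ring.
      unfold fadd, gam. rewrite !(fC_mulE (4 / PI)), ones_mulE. ring.
    - rewrite fC_mulE. unfold theta. ring. }
  apply (poly_decay_ext _ _ _ E). apply poly_decay_add.
  - apply poly_decay_scal, geo_poly_decay, Hgs.
  - apply poly_decay_add.
    + apply poly_decay_conv; assumption.
    + apply poly_decay_scal, poly_decay_conv; [apply geo_decay_theta, Hg|].
      exact (legendre_decay y y_ode).
Qed.

(** The limit is (4 / PI) (PI / 2) / 2 = 1. The factor 2 k - 1 will come from (2k-1)! = (2k-1)
    (2k-2)!; its -1 costs only O(1/k). *)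
Lemma even_coef : poly_decay 1 (fun k => (2 * INR k - 1) / 2 * (y * finv sincH)%fps k - 1).
Proof.
  pose proof PI_RGT_0.
  assert (Hs : is_series (finv sincH) (PI / 2)).
  { replace (PI / 2) with (/ (2 / PI)) by (field; lra).
    apply is_series_finv; [exact sincH_0 | exact is_series_sincH | exact geo_decay_sincH
      | exact geo_decay_finv_sincH |].
    apply Rgt_not_eq, Rdiv_lt_0_compat; lra. }
  pose proof (product_coef _ _ geo_decay_finv_sincH Hs) as H1.
  pose proof (poly_decay_conv 1 _ _ geo_decay_finv_sincH (legendre_decay y y_ode)) as H2.
  apply (poly_decay_scal 1 (/ 2)) in H1. apply (poly_decay_scal 1 (- / 2)) in H2.
  pose proof (poly_decay_add _ _ _ H1 H2) as H3. revert H3. apply poly_decay_ext.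
  intros n. unfold fadd. rewrite !fC_mulE, (fmulC y). field. lra.
Qed.

Lemma ln_step (x : R) : 0 < x ->
  Rabs (/ x - (ln (x + 1) - ln x)) <= / x ^ 2.
Proof.
  intros Hx. assert (Hi : 0 < / x) by (apply Rinv_0_lt_compat, Hx).
  rewrite <- ln_div by lra. replace ((x + 1) / x) with (1 + / x) by (field; lra).
  pose proof (ln_remainder 0 (/ x) ltac:(lra)) as H. simpl in H.
  rewrite Rabs_minus_sym.
  replace (ln (1 + / x) - / x) with (ln (1 + / x) - 1 / 1 * (/ x * 1)) by (field; lra).
  replace (/ x ^ 2) with (/ x * (/ x * 1)) by (field; lra). exact H.
Qed.

(** By [finv_cosH] these are partial sums of coefficients 8 / (PI^2 n) + O(1/n^2), where 8 / PI^2 is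
    half of (4 / PI)^2. *)
Lemma odd_coef : exists C, forall k,
  Rabs ((y * finv cosH)%fps k - 8 / PI ^ 2 * ln (INR (S k))) <= C.
Proof.
  pose proof PI_RGT_0.
  assert (Hs : is_series (finv cosQ) (4 / PI)).
  { replace (4 / PI) with (/ (PI / 4)) by (field; lra).
    apply is_series_finv; [exact cosQ_0 | exact is_series_cosQ | exact geo_decay_cosQ
      | exact geo_decay_finv_cosQ |].
    apply Rgt_not_eq, Rdiv_lt_0_compat; lra. }
  pose proof (product_coef _ _ geo_decay_finv_cosQ Hs) as H1.
  set (r := (y * finv cosQ)%fps) in *.
  (* Increments of the difference to be bounded: r and the step of the logarithm agree up to
     O(1/n^2), so these increments are summable. *)
  set (t := fun n => match n with O => r O
    | S m => r (S m) - 8 / PI ^ 2 * (ln (INR (S (S m))) - ln (INR (S m))) end).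
  assert (Ht : poly_decay 2 t).
  { apply poly_decay_tail. apply poly_decay_nonneg in H1. destruct H1 as (K & HK & H1).
    exists (K + 8 / PI ^ 2). intros n. cbn [t]. specialize (H1 (S n)). rewrite pow_1 in H1.
    pose proof (INR_S_pos n) as Hn. pose proof (ln_step (INR (S n)) Hn) as Hl.
    rewrite !(S_INR (S n)) in *. set (x := INR (S n)) in *.
    assert (H8 : 0 < 8 / PI ^ 2) by (apply Rdiv_lt_0_compat; [lra | nra]).
    replace (r (S n) - 8 / PI ^ 2 * (ln (x + 1) - ln x)) with
      (/ (2 * x) * (2 * x * r (S n) - 4 / PI * (4 / PI)) +
       8 / PI ^ 2 * (/ x - (ln (x + 1) - ln x))) by (field; lra).
    eapply Rle_trans; [apply Rabs_triang|]. rewrite !Rabs_mult.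
    assert (Hi : 0 < / (2 * x)) by (apply Rinv_0_lt_compat; lra).
    rewrite (Rabs_right (/ (2 * x))), (Rabs_right (8 / PI ^ 2)) by lra.
    unfold Rdiv at 4. rewrite Rmult_plus_distr_r. apply Rplus_le_compat.
    - apply Rle_trans with (/ (2 * x) * (K / (x + 1))).
      + apply Rmult_le_compat_l; lra.
      + replace (/ (2 * x) * (K / (x + 1))) with (K * / (2 * x * (x + 1))) by (field; lra).
        apply Rmult_le_compat_l; [exact HK|]. apply Rinv_le_contravar; nra.
    - apply Rmult_le_compat_l; [lra | exact Hl]. }
  destruct (poly_decay_series t Ht) as (l & _ & [K HK]).
  exists (Rabs l + Rabs K). intros k.
  assert (E : (y * finv cosH)%fps k - 8 / PI ^ 2 * ln (INR (S k)) = sum_f_R0 t k).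
  { rewrite finv_cosH, fmulA, ones_mulE. fold r. induction k as [|k IH].
    - cbn [sum_f_R0 t]. rewrite INR_1, ln_1. ring.
    - rewrite !tech5, <- IH. cbn [t]. ring. }
  rewrite E. specialize (HK k). rewrite pow_1 in HK.
  replace (sum_f_R0 t k) with (l + (sum_f_R0 t k - l)) by ring.
  eapply Rle_trans; [apply Rabs_triang|]. apply Rplus_le_compat_l.
  eapply Rle_trans; [exact HK|]. pose proof (INR_S_pos k).
  apply Rle_trans with (Rabs K * / INR (S k)).
  - unfold Rdiv. apply Rmult_le_compat_r; [|apply Rle_abs].
    apply Rlt_le, Rinv_0_lt_compat; assumption.
  - rewrite <- (Rmult_1_r (Rabs K)) at 2. apply Rmult_le_compat_l; [apply Rabs_pos|].
    rewrite <- Rinv_1. apply Rinv_le_contravar; [lra|]. rewrite S_INR.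
    pose proof (pos_INR k). lra.
Qed.

End Asymptotics.

Lemma lambda_pow (k : nat) : lambda ^ k = (-1) ^ k * (2 * PI) ^ (2 * k).
Proof.
  unfold lambda. rewrite pow_mult, <- Rpow_mult_distr. f_equal. ring.
Qed.

Theorem corollary2 (alpha : nat -> R) (halpha : is_landau_expansion alpha) :
  (exists eps : nat -> R,
      is_bigO eps (fun k => / INR k) /\
      eventually (fun k =>
        alpha (2 * k)%nat =
          (-1) ^ (k + 1) *
          (2 * INR (fact (2 * k - 2)) / (2 * PI) ^ (2 * k)) *
          (1 + eps k))) /\
  (exists eps : nat -> R,
      is_bigO eps (fun k => / ln (INR k)) /\
      eventually (fun k =>
        alpha (2 * k + 1)%nat =
          (-1) ^ (k + 1) *
          (8 * INR (fact (2 * k)) * ln (INR (2 * k + 1)) /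
             (2 * PI) ^ (2 * k + 2)) *
          (1 + eps k))).
Proof.
  pose proof PI_RGT_0 as Hpi.
  destruct (landau_reduction alpha halpha) as (y & Hy0 & Hode & Heven & Hodd).
  pose proof (odd_even_ratio_limit alpha halpha) as Hlim.
  assert (Hsign : forall k, (-1) ^ k * (-1) ^ k = 1).
  { intros k. rewrite <- Rpow_mult_distr. replace (-1 * -1) with 1 by ring. apply pow1. }
  (* Shared by both parities: [lambda] carries the alternating sign, and the exponent k + 1 absorbs
     the minus sign. *)
  assert (Hsolve : forall k a b f, f <> 0 -> a / f * lambda ^ k = - b ->
    a = (-1) ^ (k + 1) * (f / (2 * PI) ^ (2 * k)) * b).
  { intros k a b f Hf H. rewrite lambda_pow in H.
    assert (Hp : (2 * PI) ^ (2 * k) <> 0) by (apply pow_nonzero; lra).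
    replace b with (- (a / f * ((-1) ^ k * (2 * PI) ^ (2 * k)))) by lra.
    rewrite pow_add, pow_1.
    transitivity (((-1) ^ k * (-1) ^ k) * a); [rewrite Hsign; ring | field; auto]. }
  split.
  - exists (fun k => (2 * INR k - 1) / 2 * (y * finv sincH)%fps k - 1). split.
    + destruct (poly_decay_nonneg _ _ (even_coef y Hy0 Hode Hlim)) as (K & HK & H).
      exists K. exists 1%nat. intros k Hk. eapply Rle_trans; [apply H|].
      assert (Hkp : 0 < INR k) by (apply lt_0_INR; lia).
      rewrite pow_1, Rabs_right by (apply Rle_ge, Rlt_le, Rinv_0_lt_compat, Hkp).
      apply Rmult_le_compat_l; [exact HK|].
      apply Rinv_le_contravar; [exact Hkp | apply le_INR; lia].
    (* [landau_reduction] describes the even coefficients from index 2 on, hence the shift. *)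
    + exists 1%nat. intros [|k] Hk; [lia|].
      rewrite (Hsolve _ _ _ _ (INR_fact_neq_0 _) (Heven k)).
      replace (2 * S k - 2)%nat with (2 * k)%nat by lia.
      replace (2 * k + 1)%nat with (S (2 * k)) by lia. rewrite fact_simpl, mult_INR.
      replace (INR (S (2 * k))) with (2 * INR (S k) - 1)
        by (rewrite !S_INR, mult_INR; simpl; ring).
      field. apply pow_nonzero. lra.
  - destruct (odd_coef y Hy0 Hode Hlim) as [C HC].
    exists (fun k => (PI ^ 2 / 8 * (y * finv cosH)%fps k - ln (INR (2 * k + 1))) /
                     ln (INR (2 * k + 1))).
    assert (Hln : forall k, (2 <= k)%nat -> 0 < ln (INR k)).
    { intros k Hk. rewrite <- ln_1. apply ln_increasing; [lra|].
      apply (lt_INR 1). lia. }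
    split.
    (* ln 2 bounds the change from ln (k + 1) to ln (2 k + 1); k >= 2 makes ln k positive. *)
    + exists (PI ^ 2 / 8 * C + ln 2). exists 2%nat. intros k Hk.
      pose proof (Hln k Hk) as H1. pose proof (Hln (2 * k + 1)%nat ltac:(lia)) as H2.
      assert (Hkp : 0 < INR k) by (apply lt_0_INR; lia).
      assert (Hle : ln (INR k) <= ln (INR (2 * k + 1))).
      { apply ln_le; [exact Hkp | apply le_INR; lia]. }
      assert (Hnum : Rabs (PI ^ 2 / 8 * (y * finv cosH)%fps k - ln (INR (2 * k + 1))) <=
                     PI ^ 2 / 8 * C + ln 2).
      { assert (Hb : ln (INR (S k)) <= ln (INR (2 * k + 1)) <= ln 2 + ln (INR (S k))).
        { split.
          - apply ln_le; [apply INR_S_pos | apply le_INR; lia].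
          - rewrite <- ln_mult by (lra || apply INR_S_pos).
            apply ln_le; [apply lt_0_INR; lia|].
            replace (2 * INR (S k)) with (INR (2 * S k)) by (rewrite mult_INR; reflexivity).
            apply le_INR. lia. }
        replace (PI ^ 2 / 8 * (y * finv cosH)%fps k - ln (INR (2 * k + 1))) with
          (PI ^ 2 / 8 * ((y * finv cosH)%fps k - 8 / PI ^ 2 * ln (INR (S k))) +
           (ln (INR (S k)) - ln (INR (2 * k + 1)))) by (field; lra).
        eapply Rle_trans; [apply Rabs_triang|]. rewrite Rabs_mult.
        assert (Hp8 : 0 < PI ^ 2 / 8) by nra.
        rewrite (Rabs_right (PI ^ 2 / 8)) by lra. apply Rplus_le_compat.
        - apply Rmult_le_compat_l; [lra | apply HC].
        - apply Rabs_le. lra. }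
      unfold Rdiv at 1. rewrite Rabs_mult, Rabs_inv, Rabs_inv.
      rewrite (Rabs_right (ln (INR (2 * k + 1)))), (Rabs_right (ln (INR k))) by lra.
      apply Rmult_le_compat; [apply Rabs_pos | | exact Hnum |].
      * apply Rlt_le, Rinv_0_lt_compat, H2.
      * apply Rinv_le_contravar; assumption.
    + exists 1%nat. intros k Hk.
      rewrite (Hsolve _ _ _ _ (INR_fact_neq_0 _) (Hodd k)).
      pose proof (Hln (2 * k + 1)%nat ltac:(lia)) as H2.
      rewrite (pow_add (2 * PI) (2 * k) 2).
      assert ((2 * PI) ^ (2 * k) <> 0) by (apply pow_nonzero; lra).
      field. repeat split; lra.
Qed.
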